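(* Let $R$ be a regular local ring and let $J \subset R$ be an ideal of height two that can be generated by three elements. Denote by $I = J^{\mathrm{unm}}$ the unmixed part of $J$, and let $a,b \in I$ be a regular sequence with $(a,b) \neq I$. Then $$\operatorname{pd}_R(R/J) \leq \operatorname{pd}_R\bigl(R/((a,b):I)\bigr) + 1,$$ and equality holds if $\operatorname{pd}_R(R/J) \geq 4$.
   Context: The unmixed part $J^{\mathrm{unm}}$ of an ideal $J$ in a Noetherian ring is the intersection of those primary components $Q$ of $J$ (in a primary decomposition) with $\operatorname{ht}(Q) = \operatorname{ht}(J)$, where $\operatorname{ht}$ denotes height. For ideals $A,B$ of $R$, $A:B = \{r \in R : rB \subseteq A\}$. $\operatorname{pd}_R$ denotes projective dimension over $R$. *)

(* Defs.v *)
From HB Require Import structures.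
From mathcomp Require Import all_boot all_order all_algebra.
From mathcomp Require Import all_classical.
From mathcomp Require Import constructive_ereal.

Set Implicit Arguments.
Unset Strict Implicit.
Unset Printing Implicit Defensive.

Import Order.TTheory GRing.Theory Num.Theory.

Local Open Scope classical_set_scope.
Local Open Scope ring_scope.
Local Open Scope quotient_scope.

(* Least element of a set of naturals, +oo for the empty set; heights and
   homological dimensions live in \bar int so that they can be infinite. *)
Definition inf_nat (A : set nat) : \bar int :=
  if pselect (exists n, n \in A) is left An then (ex_minn An)%:Z%:E else +oo%E.

(* The least upper bound, i.e. +oo exactly when [A] is unbounded. *)
Definition sup_nat (A : set nat) : \bar int :=
  inf_nat [set n | forall m, A m -> (m <= n)%N].

Definition ideal_closed (R : comNzRingType) (S : set R) : Prop :=
  S 0 /\ forall a x y, S x -> S y -> S (a * x + y).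

(* Unlike [idealr], the unit ideal is allowed. *)
Record ideal (R : comNzRingType) := Ideal {
  ideal_set :> set R;
  idealP : ideal_closed ideal_set
}.

(* Membership is written [I x]; [set] itself has no coercion to functions. *)
Definition ideal_has (R : comNzRingType) (I : ideal R) (x : R) : Prop :=
  ideal_set I x.
Coercion ideal_has : ideal >-> Funclass.

Section Ideals.
Variable R : comNzRingType.
Implicit Types (I J P Q m : ideal R) (s : seq R).

Definition ideal_span_set s : set R :=
  [set x | exists c : nat -> R, x = \sum_(i < size s) c i * s`_i].

Lemma ideal_span_closed s : ideal_closed (ideal_span_set s).
Proof.
split=> [|a _ _ [c ->] [d ->]].
  by exists (fun=> 0); rewrite big1 // => i _; rewrite mul0r.
exists (fun i => a * c i + d i); rewrite big_distrr -big_split /=.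
by apply: eq_bigr => i _; rewrite mulrDl mulrA.
Qed.

Definition ideal_span s : ideal R := Ideal (ideal_span_closed s).

Definition colon_set I J : set R := [set r | forall x, J x -> I (r * x)].

Lemma colon_closed I J : ideal_closed (colon_set I J).
Proof.
have [I0 ID] := idealP I; split=> [x _|a x y Ix Iy z Jz]; first by rewrite mul0r.
by rewrite mulrDl -mulrA; apply: ID; [exact: Ix|exact: Iy].
Qed.

Definition colon I J : ideal R := Ideal (colon_closed I J).

Definition is_proper I : Prop := ~ I 1.

Definition prime_ideal P : Prop :=
  is_proper P /\ forall x y, P (x * y) -> P x \/ P y.

Definition primary_ideal Q : Prop :=
  is_proper Q /\ forall x y, Q (x * y) -> Q x \/ exists n : nat, Q (y ^+ n).

Definition maximal_ideal m : Prop :=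
  is_proper m /\ forall I, is_proper I -> m `<=` I -> I = m :> set R.

Definition prime_chain (n : nat) (p : nat -> ideal R) : Prop :=
  (forall i, (i <= n)%N -> prime_ideal (p i)) /\
  (forall i, (i < n)%N -> p i `<` p i.+1).

Definition krull_dim : \bar int :=
  sup_nat [set n | exists p, prime_chain n p].

Definition prime_height P : \bar int :=
  sup_nat [set n | exists p, prime_chain n p /\ p n = P :> set R].

(* The infimum of the heights of the primes containing [I]. *)
Definition height I : \bar int :=
  inf_nat [set n | exists P,
    [/\ prime_ideal P, I `<=` P & prime_height P = n%:Z%:E]].

Definition min_gens I : \bar int :=
  inf_nat [set n | exists s, size s = n /\ I = ideal_span s :> set R].

Definition noetherian : Prop :=
  forall I, exists s, I = ideal_span s :> set R.

Definition regular_local : Prop :=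
  noetherian /\
  exists m, [/\ maximal_ideal m,
                forall n, maximal_ideal n -> n = m :> set R
              & min_gens m = krull_dim].

Definition regular_seq s : Prop :=
  is_proper (ideal_span s) /\
  forall i, (i < size s)%N ->
    forall x, ideal_span (take i s) (x * s`_i) -> ideal_span (take i s) x.

Definition primary_decomposition J (n : nat) (Q : 'I_n -> ideal R) : Prop :=
  (forall i, primary_ideal (Q i)) /\
  J = \bigcap_(i in [set: 'I_n]) Q i :> set R.

(* The decomposition need not be irredundant: when [height J] is finite, a
   [Q i] containing [J] and of the same height has a minimal prime of [J] as
   its radical, and these components intersect to the same ideal in every
   decomposition. *)
Definition unmixed_part J I : Prop :=
  exists (n : nat) (Q : 'I_n -> ideal R),
    primary_decomposition J Q /\
    I = \bigcap_(i in [set i | height (Q i) = height J]) Q i :> set R.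

Definition ideal_mem I : {pred R} := fun x => x \in (I : set R).

Lemma ideal_mem_zmod I : zmod_closed (ideal_mem I).
Proof.
have [I0 ID] := idealP I; split=> [|x y]; rewrite !unfold_in ?inE // => Ix Iy.
by rewrite addrC -mulN1r; apply: ID.
Qed.

HB.instance Definition _ I :=
  GRing.isZmodClosed.Build R (ideal_mem I) (ideal_mem_zmod I).

Definition quot_mod I : Type := {ideal_quot (ideal_mem I)}.

HB.instance Definition _ I := GRing.Zmodule.on (quot_mod I).

Definition quot_proj I (x : R) : quot_mod I := \pi_{ideal_quot (ideal_mem I)} x.

Definition quot_scale I (a : R) (u : quot_mod I) : quot_mod I :=
  quot_proj I (a * repr (u : {ideal_quot (ideal_mem I)})).

Lemma quot_projK I (u : quot_mod I) :
  quot_proj I (repr (u : {ideal_quot (ideal_mem I)})) = u.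
Proof. exact: reprK. Qed.

Lemma quot_proj_eq I x y : quot_proj I x = quot_proj I y <-> I (x - y).
Proof.
split=> [/eqP|Ixy]; last (apply/eqP; move: Ixy).
  by rewrite -Quotient.idealrBE unfold_in inE.
by rewrite -Quotient.idealrBE unfold_in inE.
Qed.

Lemma quot_projD I x y : quot_proj I (x + y) = quot_proj I x + quot_proj I y.
Proof. exact: Quotient.pi_add. Qed.

Lemma quot_scale_proj I a x : quot_scale a (quot_proj I x) = quot_proj I (a * x).
Proof.
apply/quot_proj_eq; rewrite -mulrBr -[_ * _]addr0.
have [I0 ID] := idealP I; apply: ID => //.
by apply/quot_proj_eq; rewrite quot_projK.
Qed.

Fact quot_scaleA I a b (u : quot_mod I) :
  quot_scale a (quot_scale b u) = quot_scale (a * b) u.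
Proof. by rewrite -[u]quot_projK !quot_scale_proj mulrA. Qed.

Fact quot_scale1 I : left_id 1 (@quot_scale I).
Proof. by move=> u; rewrite -[u]quot_projK quot_scale_proj mul1r. Qed.

Fact quot_scaleDr I : right_distributive (@quot_scale I) +%R.
Proof.
move=> a u v; rewrite -[u]quot_projK -[v]quot_projK -quot_projD.
by rewrite !quot_scale_proj mulrDr quot_projD.
Qed.

Fact quot_scaleDl I (u : quot_mod I) : {morph (@quot_scale I)^~ u : a b / a + b}.
Proof.
by move=> a b; rewrite -[u]quot_projK !quot_scale_proj mulrDl quot_projD.
Qed.

HB.instance Definition _ I :=
  GRing.Zmodule_isLmodule.Build R (quot_mod I)
    (@quot_scaleA I) (@quot_scale1 I) (@quot_scaleDr I) (@quot_scaleDl I).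

End Ideals.

Section ProjectiveDimension.
Variable R : comNzRingType.

Definition projective (P : lmodType R) : Prop :=
  forall (A B : lmodType R) (g : {linear A -> B}) (f : {linear P -> B}),
    (forall b, exists a, g a = b) ->
    exists h : {linear P -> A}, forall x, g (h x) = f x.

Definition projective_resolution (M : lmodType R) (P : nat -> lmodType R)
    (d : forall i, {linear P i.+1 -> P i}) (e : {linear P 0%N -> M}) : Prop :=
  [/\ forall i, projective (P i),
      forall y, exists x, e x = y,
      forall x, e x = 0 <-> exists z, d 0%N z = x
    & forall i x, d i x = 0 <-> exists z, d i.+1 z = x].

Definition has_proj_res (M : lmodType R) (n : nat) : Prop :=
  exists P d e, @projective_resolution M P d e /\
    forall i, (n < i)%N -> forall x : P i, x = 0.

(* The zero module gets dimension 0. *)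
Definition pdim (M : lmodType R) : \bar int := inf_nat [set n | has_proj_res M n].

End ProjectiveDimension.

(* Main.v *)
(* Write J = (x,y,z) with x,y a regular sequence.  Since the associated primes
   of (x,y) have height two, (x,y) : I = (x,y) : J = (x,y) : z, which gives an
   exact sequence 0 -> R/((x,y):I) -> R/(x,y) -> R/J -> 0.  It remains to see
   that R/((x,y):I) and R/((a,b):I) satisfy the same bounds pd <= n, n >= 2.
   If b and c in I are nonzerodivisors modulo a, then ((a,b):I)/(a) and
   ((a,c):I)/(a) are isomorphic through multiplication by the fraction c/b;
   this connects (a,b) to (x,y) along (a,b), (a,c), (c,x), (x,y) for a common c.
   The case n < 2 is void, because (a,b):I is not projective.

   A regular local ring is a Cohen-Macaulay domain by Krull's principal ideal
   theorem: generators of the maximal ideal, as many as the dimension, form a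
   regular sequence.  The bound on the height of the associated primes follows
   because P in Ass(R/A) lies properly below some prime of Ass(R/(A,t)) for every
   nonzerodivisor t on R/A in the maximal ideal. *)

Require Import Defs.
From HB Require Import structures.
From mathcomp Require Import all_boot all_order all_algebra.
From mathcomp Require Import all_classical.
From mathcomp Require Import constructive_ereal.
From mathcomp Require Import ring.

Set Implicit Arguments.
Unset Strict Implicit.
Unset Printing Implicit Defensive.

Import Order.TTheory GRing.Theory Num.Theory.

Local Open Scope classical_set_scope.
Local Open Scope ring_scope.

(** * Ideal arithmetic: adjoined elements, annihilators, nonzerodivisors *)

Section IdealArithmetic.
Variable R : comNzRingType.
Implicit Types (A B I J K P Q : ideal R) (r s t u w x y : R).

Lemma ideal_ext A B : (forall x, A x <-> B x) -> A = B.
Proof.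
case: A B => [A hA] [B hB] AB; have eAB : A = B by apply/seteqP; split=> x /AB.
by subst B; congr Ideal; apply: Prop_irrelevance.
Qed.

Lemma ideal_anti A B : A `<=` B -> B `<=` A -> A = B.
Proof. by move=> AB BA; apply: ideal_ext => x; split; [apply: AB | apply: BA]. Qed.

Lemma ideal0 A : A 0. Proof. exact: (idealP A).1. Qed.

Lemma ideal_mull A r x : A x -> A (r * x).
Proof. by move=> Ax; rewrite -[_ * _]addr0; apply: (idealP A).2 => //; apply: ideal0. Qed.

Lemma ideal_mulr A r x : A x -> A (x * r).
Proof. by rewrite mulrC; apply: ideal_mull. Qed.

Lemma idealD A x y : A x -> A y -> A (x + y).
Proof. by move=> Ax Ay; rewrite -[x]mul1r; apply: (idealP A).2. Qed.

Lemma idealN A x : A x -> A (- x).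
Proof. by rewrite -mulN1r; apply: ideal_mull. Qed.

Lemma idealB A x y : A x -> A y -> A (x - y).
Proof. by move=> Ax Ay; apply: idealD => //; apply: idealN. Qed.

Lemma ideal_subr A x y : A (x - y) -> A y -> A x.
Proof. by move=> Axy Ay; rewrite -[x](subrK y); apply: idealD. Qed.

Lemma ideal_addr A x y : A (x + y) -> A y -> A x.
Proof. by move=> Axy Ay; rewrite -[x](addrK y); apply: idealB. Qed.

Lemma ideal1_full A x : A 1 -> A x.
Proof. by move=> A1; rewrite -[x]mulr1; apply: ideal_mull. Qed.

Lemma zero_ideal_closed : ideal_closed [set x : R | x = 0].
Proof. by split=> // a x y /= -> ->; rewrite mulr0 addr0. Qed.

Definition zero_ideal : ideal R := Ideal zero_ideal_closed.

Lemma adjoin_closed A t :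
  ideal_closed [set x | exists a r, A a /\ x = a + r * t].
Proof.
split=> [|c _ _ [a [r [Aa ->]]] [b [s [Ab ->]]]].
  by exists 0, 0; split; [exact: ideal0 | rewrite mul0r addr0].
exists (c * a + b), (c * r + s); split; last by ring.
by apply: idealD => //; apply: ideal_mull.
Qed.

Definition adjoin A t : ideal R := Ideal (adjoin_closed A t).

Lemma sub_adjoin A t x : A x -> adjoin A t x.
Proof. by exists x, 0; rewrite mul0r addr0. Qed.

Lemma adjoin_gen A t : adjoin A t t.
Proof. by exists 0, 1; rewrite mul1r add0r; split=> //; apply: ideal0. Qed.

Lemma adjoin_min A B t : A `<=` B -> B t -> adjoin A t `<=` B.
Proof.
by move=> AB Bt _ [a [r [Aa ->]]]; apply: (@idealD B); [exact: AB|exact: ideal_mull].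
Qed.

Lemma sub_adjoinAC A x y : adjoin (adjoin A x) y `<=` adjoin (adjoin A y) x.
Proof.
apply: adjoin_min; last by apply: sub_adjoin; apply: adjoin_gen.
apply: adjoin_min; last exact: adjoin_gen.
by move=> z Az; apply: sub_adjoin; apply: sub_adjoin.
Qed.

Lemma adjoinAC A x y : adjoin (adjoin A x) y = adjoin (adjoin A y) x.
Proof. by apply: ideal_anti; apply: sub_adjoinAC. Qed.

Lemma quotient_elt_closed A u : ideal_closed [set r | A (r * u)].
Proof.
split=> [|c x y /= Ax Ay]; first by rewrite /= mul0r; apply: ideal0.
by rewrite /= mulrDl -mulrA; apply: idealD => //; apply: ideal_mull.
Qed.

(** The annihilator [A : u] of the class of [u] in R/A; the prime ideals of this form are the
    associated primes of R/A. *)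
Definition quotient_elt A u : ideal R := Ideal (quotient_elt_closed A u).

Lemma quotient_elt_congr A x y : A (x - y) -> quotient_elt A x = quotient_elt A y.
Proof.
move=> Axy; apply: ideal_ext => w; rewrite /ideal_has /=; split=> Aw.
  by apply: (ideal_subr (y := w * x)) => //; rewrite -mulrBr -opprB mulrN;
    apply: idealN; apply: ideal_mull.
by apply: (ideal_subr (y := w * y)) => //; rewrite -mulrBr; apply: ideal_mull.
Qed.

(** The class of [u] spans a copy of the domain R/(A : u), whose nonzero elements all have the same
    annihilator. *)
Lemma prime_quotient_eltM A u r : prime_ideal (quotient_elt A u) -> ~ A (r * u) ->
  quotient_elt A (r * u) = quotient_elt A u.
Proof.
move=> uP nAru; apply: ideal_ext => w; split=> [Aw|Aw].
  by have [|//|//] := (proj2 uP) w r; rewrite /ideal_has /= -mulrA.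
by rewrite /ideal_has /= mulrCA; apply: ideal_mull.
Qed.

Lemma span_gen (l : seq R) x : x \in l -> ideal_span l x.
Proof.
move=> xl; exists (fun i => (i == index x l)%:R).
have lt : (index x l < size l)%N by rewrite index_mem.
rewrite (bigD1 (Ordinal lt)) //= eqxx mul1r nth_index // big1 ?addr0 //.
by move=> i; rewrite -val_eqE /= => /negPf ->; rewrite mul0r.
Qed.

Lemma span_min (l : seq R) A : (forall x, x \in l -> A x) -> ideal_span l `<=` A.
Proof.
move=> lA _ [c ->]; apply: (big_ind (ideal_has A)).
- exact: ideal0.
- exact: idealD.
- by move=> i _; apply: ideal_mull; apply: lA; apply: mem_nth.
Qed.

(** A left fold, so that induction on the list absorbs its first element into [A]. *)
Definition adjoins A (l : seq R) : ideal R := foldl adjoin A l.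

Lemma sub_adjoins A l : A `<=` adjoins A l.
Proof.
by elim: l A => [A x //|t l IH A x Ax]; apply: (IH (adjoin A t)); apply: sub_adjoin.
Qed.

Lemma adjoins_gen A l x : x \in l -> adjoins A l x.
Proof.
elim: l A => //= t l IH A; rewrite inE => /orP[/eqP ->|]; last exact: IH.
by apply: sub_adjoins; apply: adjoin_gen.
Qed.

Lemma adjoins_min A B l :
  A `<=` B -> (forall x, x \in l -> B x) -> adjoins A l `<=` B.
Proof.
elim: l A => [A AB _ //|t l IH A AB lB]; apply: (IH (adjoin A t)).
  by apply: adjoin_min => //; apply: lB; rewrite inE eqxx.
by move=> x xl; apply: lB; rewrite inE xl orbT.
Qed.

Lemma ideal_span_adjoins l : ideal_span l = adjoins zero_ideal l.
Proof.
apply: ideal_anti; first by apply: span_min => x; apply: adjoins_gen.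
by apply: adjoins_min => [_ ->|x]; [exact: (ideal0 (ideal_span l)) | exact: span_gen].
Qed.

Lemma span_seq2 x y : ideal_span [:: x; y] = adjoin (adjoin zero_ideal x) y.
Proof. exact: ideal_span_adjoins. Qed.

Lemma span_seq3 x y z :
  ideal_span [:: x; y; z] = adjoin (adjoin (adjoin zero_ideal x) y) z.
Proof. exact: ideal_span_adjoins. Qed.

(* [t] is a nonzerodivisor on [R/A]; no condition [A + (t) != R] is imposed. *)
Definition nzd A t := forall w, A (t * w) -> A w.

Lemma prime_nzd P t : prime_ideal P -> ~ P t -> nzd P t.
Proof. by move=> [_ pP] nPt w /pP []. Qed.

Lemma not_sub A B : ~ (A `<=` B) -> exists x, A x /\ ~ B x.
Proof.
move=> nAB; apply: contrapT => nex; apply: nAB => x Ax.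
by apply: contrapT => nBx; apply: nex; exists x.
Qed.

Lemma proper_sub A B : A `<=` B -> A <> B -> A `<` B.
Proof. by move=> AB nAB; split=> // BA; apply: nAB; apply: ideal_anti. Qed.

Lemma proper_adjoin A x : ~ A x -> A `<` adjoin A x.
Proof.
move=> nAx; split=> [y|]; first exact: sub_adjoin.
by move=> /(_ x (adjoin_gen _ _)).
Qed.

End IdealArithmetic.

(** * Noetherian induction and associated primes *)

Section Noetherian.
Variable R : comNzRingType.
Hypothesis noethR : noetherian R.
Implicit Types (A B I J K P Q : ideal R) (r s t u w x y : R).

Lemma noeth_span A : exists l, A = ideal_span l.
Proof.
have [l Al] := noethR A; exists l; apply: ideal_ext => x.
by rewrite /ideal_has Al.
Qed.

(** A counterexample would start, by choice, a strictly increasing sequence of counterexamples; but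
    its union is finitely generated, hence reached at a finite stage. *)
Lemma noeth_ind (T : ideal R -> Prop) :
  (forall A, (forall B, A `<` B -> T B) -> T A) -> forall A, T A.
Proof.
move=> IH A0; apply: contrapT => nT0.
have step (A : {A | ~ T A}) : {B : {A | ~ T A} | sval A `<` sval B}.
  apply: cid; apply: contrapT => nex; case: A nex => A nTA /= nex.
  apply: nTA; apply: IH => B AB; apply: contrapT => nTB; apply: nex.
  by exists (exist _ B nTB).
pose F n : {A | ~ T A} := iter n (fun X => sval (step X)) (exist _ A0 nT0).
have FS n : sval (F n) `<` sval (F n.+1) by rewrite /F /=; case: (step _).
have Fle n k x : sval (F n) x -> sval (F (n + k)%N) x.
  elim: k => [|k IHk] Fx; first by rewrite addn0.
  by rewrite addnS; apply: (proj1 (FS _)); apply: IHk.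
have Uc : ideal_closed [set x | exists n, sval (F n) x].
  split=> [|a x y [n Fx] [k Fy]]; first by exists 0%N; apply: ideal0.
  exists (n + k)%N; apply: (@idealD _ (sval (F (n + k)%N))).
    by apply: (@ideal_mull _ (sval (F (n + k)%N))); apply: Fle.
  by rewrite addnC; apply: Fle.
have [l Ul] := noeth_span (Ideal Uc).
have [n ln] : exists n, forall x, x \in l -> sval (F n) x.
  have : forall x, x \in l -> Ideal Uc x by move=> x; rewrite Ul; apply: span_gen.
  elim: (l) => [|x l' IHl] lU; first by exists 0%N.
  have [|n ln] := IHl; first by move=> y yl; apply: lU; rewrite inE yl orbT.
  have [k Fkx] : Ideal Uc x by apply: lU; rewrite inE eqxx.
  exists (n + k)%N => y; rewrite inE => /orP[/eqP ->|/ln]; last exact: Fle.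
  by rewrite addnC; apply: Fle.
apply: (proj2 (FS n)) => x Fx; apply: (@span_min _ l) => //.
by rewrite -Ul; exists n.+1.
Qed.

Lemma noeth_max (T : ideal R -> Prop) A : T A ->
  exists B, [/\ T B, A `<=` B & forall C : ideal R, B `<` C -> ~ T C].
Proof.
move: A; elim/noeth_ind => A IH TA.
case: (pselect (exists2 B : ideal R, A `<` B & T B)) => [[B AB TB]|nex].
  have [C [TC BC Cmax]] := IH B AB TB; exists C; split=> //.
  by move=> x /(proj1 AB) /BC.
by exists A; split=> // C AC TC; apply: nex; exists C.
Qed.

(** A maximal element among the annihilators of nonzero classes is prime: if [x * y] kills [v] and
    [x] does not, then [x * v] has the same annihilator as [v], and [y] is in it. *)
Lemma zero_divisor_assoc A u w : ~ A u -> A (w * u) ->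
  exists v, [/\ ~ A v, prime_ideal (quotient_elt A v),
                quotient_elt A u `<=` quotient_elt A v
              & quotient_elt A v w].
Proof.
move=> nAu Awu.
pose T B := exists2 v, ~ A v & B = quotient_elt A v.
have [|B [[v nAv ->] uv vmax]] := @noeth_max T (quotient_elt A u).
  by exists u.
exists v; split=> //; last by apply: uv.
split=> [A1|x y Axy]; first by apply: nAv; move: A1; rewrite /ideal_has /= mul1r.
case: (pselect (A (x * v))) => [|nAxv]; [by left | right].
have sub : quotient_elt A v `<=` quotient_elt A (x * v).
  by move=> z Az; rewrite /= mulrCA; apply: ideal_mull.
have eqv : quotient_elt A v = quotient_elt A (x * v).
  apply: contrapT => nev; apply: (vmax (quotient_elt A (x * v))).
    exact: proper_sub.
  by exists (x * v).
by rewrite eqv /ideal_has /= mulrCA mulrA.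
Qed.

(** Noetherian induction, with [s] such that [A : s] is prime. If some multiple of [u] lies in
    [A + (s)] outside [A], then [A : u] equals [A : s]; otherwise [A : u] is associated to the
    larger ideal [A + (s)]. *)
Lemma assoc_finite A : exists l : seq (ideal R),
  forall u, prime_ideal (quotient_elt A u) -> List.In (quotient_elt A u) l.
Proof.
move: A; elim/noeth_ind => A IH.
case: (pselect (A 1)) => [A1|nA1].
  by exists [::] => u [pu _]; case: pu; apply: (@ideal1_full _ A).
have [|s [nAs sP _ _]] := @zero_divisor_assoc A 1 0 nA1.
  by rewrite mul0r; apply: ideal0.
have [l lP] := IH _ (proper_adjoin nAs).
exists (quotient_elt A s :: l) => u uP.
case: (pselect (exists r, adjoin A s (r * u) /\ ~ A (r * u))) => [|nex].
  move=> [r [[a [v [Aa ruE]]] nAru]]; left.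
  have nAvs : ~ A (v * s) by move=> Avs; apply: nAru; rewrite ruE; apply: idealD.
  rewrite -(prime_quotient_eltM uP nAru) -(prime_quotient_eltM sP nAvs).
  by apply: quotient_elt_congr; rewrite ruE opprD addrCA subrr addr0; apply: idealN.
right; have eAs : quotient_elt (adjoin A s) u = quotient_elt A u.
  apply: ideal_anti => w Aw; last exact: sub_adjoin.
  by apply: contrapT => nAw; apply: nex; exists w.
by rewrite -eAs; apply: lP; rewrite eAs.
Qed.

End Noetherian.

(** * Prime avoidance *)

Section PrimeAvoidance.
Variable R : comNzRingType.
Implicit Types (A B H I J K P Q : ideal R) (r s t u w x y : R).

(** The witness is a product of elements outside [P], one from [H] and one from each [Q] not inside
    [P]. *)
Lemma prime_avoid_sub P H (l : seq (ideal R)) : prime_ideal P -> ~ H `<=` P ->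
  exists x, [/\ H x, ~ P x & forall Q, List.In Q l -> ~ Q `<=` P -> Q x].
Proof.
move=> pP nHP; elim: l => [|Q l [x [Hx nPx lx]]].
  by have [x [Hx nPx]] := not_sub nHP; exists x.
case: (pselect (Q `<=` P)) => [QP|nQP].
  by exists x; split=> // Q' [<- //|]; apply: lx.
have [y [Qy nPy]] := not_sub nQP; exists (x * y); split.
- exact: ideal_mulr.
- by move=> /(proj2 pP)[].
- move=> Q' [<- _|Q'l nQ'P]; first exact: ideal_mull.
  by apply: ideal_mulr; apply: lx.
Qed.

Lemma prime_avoidance H x (l : seq (ideal R)) :
  (forall P, List.In P l -> prime_ideal P /\ (P x -> ~ H `<=` P)) ->
  exists2 h, H h & forall P, List.In P l -> ~ P (x + h).
Proof.
elim: l => [|P l IH] lP; first by exists 0 => //; apply: ideal0.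
have [|h Hh lh] := IH; first by move=> Q Ql; apply: lP; right.
case: (pselect (P (x + h))) => [Pxh|nPxh]; last first.
  by exists h => // Q [<- //|]; apply: lh.
have [pP PHx] := lP P (or_introl erefl).
have nHP : ~ H `<=` P.
  by move=> HP; apply: (PHx _ HP); apply: (ideal_addr Pxh); apply: HP.
have [y [Hy nPy ly]] := prime_avoid_sub l pP nHP.
have nPxhy : ~ P (x + (h + y)) by move=> Pxhy; apply: nPy;
  apply: (ideal_addr (y := x + h)) => //; rewrite addrC -addrA.
exists (h + y); first exact: idealD.
(* For [Q] inside [P], avoiding [P] is enough; any other [Q] contains [y], so adding [y] does not
   affect whether the sum is in [Q]. *)
move=> Q [<- //|Ql]; case: (pselect (Q `<=` P)) => [QP /QP //|nQP].
by rewrite addrA => /ideal_addr Qxh; apply: (lh _ Ql); apply: Qxh; apply: ly.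
Qed.

Hypothesis noethR : noetherian R.

(** The hypotheses say that no associated prime of [A] or [B] contains both [x] and [H]; the zero
    divisors form the union of these finitely many primes. *)
Lemma nzd_avoidance A B H x :
  (forall u, A (x * u) -> (forall h, H h -> A (h * u)) -> A u) ->
  (forall u, B (x * u) -> (forall h, H h -> B (h * u)) -> B u) ->
  exists2 h, H h & nzd A (x + h) /\ nzd B (x + h).
Proof.
move=> HA HB.
have [lA lAP] := assoc_finite noethR A; have [lB lBP] := assoc_finite noethR B.
pose assoc (C P : ideal R) := exists u, [/\ ~ C u, P = quotient_elt C u & prime_ideal P].
(* The lists of [assoc_finite] are only known to cover the associated primes, so other members are
   filtered out. *)
pose l := List.filter (fun P => `[< assoc A P \/ assoc B P >]) (lA ++ lB).
have [|h Hh hl] := @prime_avoidance H x l.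
  move=> P /List.filter_In[_ /asboolP AP]; split; first by case: AP => [] [u []].
  case: AP => -[u [nu -> _]] xu uH; apply: nu; [apply: HA | apply: HB] => //.
exists h => //; split=> w Cw; apply: contrapT => nCw.
  have [v [nv pv _ vx]] := zero_divisor_assoc noethR nCw Cw.
  apply: (hl _ _ vx); apply/List.filter_In; split; last first.
    by apply/asboolP; left; exists v.
  by apply/List.in_app_iff; left; apply: lAP.
have [v [nv pv _ vx]] := zero_divisor_assoc noethR nCw Cw.
apply: (hl _ _ vx); apply/List.filter_In; split; last first.
  by apply/asboolP; right; exists v.
by apply/List.in_app_iff; right; apply: lBP.
Qed.

End PrimeAvoidance.

(** * Krull's principal ideal theorem and height theorem *)

Section Krull.
Variable R : comNzRingType.
Hypothesis noethR : noetherian R.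
Implicit Types (A B C I J K P Q : ideal R) (r s t u w x y : R).

(* Nakayama's lemma in the localization at [P]. *)
Lemma nakayama P t A K : prime_ideal P -> P t ->
  (forall k, K k -> exists s a k', [/\ ~ P s, A a, K k' & s * k = a + t * k']) ->
  exists2 e, ~ P e & forall k, K k -> A (e * k).
Proof.
move=> [nP1 pP] Pt.
have [l Kl] := noeth_span noethR K.
have lK x : x \in l -> K x by rewrite Kl; apply: span_gen.
have KAl : K `<=` adjoins A l by rewrite Kl; apply: span_min => x; apply: adjoins_gen.
move: lK KAl; clear Kl; elim: l A => [|x l IH] A lK KAl KA.
  by exists 1 => // k Kk; rewrite mul1r; apply: KAl.
have Kx : K x by apply: lK; rewrite inE eqxx.
have [||k Kk|e nPe eK] := IH (adjoin A x).
- by move=> y yl; apply: lK; rewrite inE yl orbT.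
- exact: KAl.
- have [s [a [k' [nPs Aa Kk' E]]]] := KA k Kk.
  by exists s, a, k'; split=> //; apply: sub_adjoin.
have [s [a [k [nPs Aa Kk E]]]] := KA x Kx.
have [b [r [Ab E']]] := eK k Kk.
(* The generator [x] is eliminated: [e * s - t * r] carries it into [A], and is outside [P] because
   [t] is in [P] and [e * s] is not. *)
have Aesx : A ((e * s - t * r) * x).
  have -> : (e * s - t * r) * x = e * a + t * b.
    rewrite mulrBl -mulrA E.
    have -> : e * (a + t * k) = e * a + t * (e * k) by ring.
    by rewrite E'; ring.
  by apply: idealD; apply: ideal_mull.
have nPes : ~ P (e * s - t * r).
  move=> /ideal_subr Pes; have /pP[] : P (e * s) by apply: Pes; apply: ideal_mulr.
    exact: nPe.
  exact: nPs.
exists ((e * s - t * r) * e); first by move=> /pP[].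
move=> k' Kk'; have [c [q [Ac E'']]] := eK k' Kk'.
rewrite -mulrA E'' mulrDr; apply: idealD; first exact: ideal_mull.
by rewrite mulrCA; apply: ideal_mull.
Qed.

(* The localization at [P] of [R/B] is Artinian. *)
Lemma descending_stabilizes P B : prime_ideal P ->
  (forall P' : ideal R, prime_ideal P' -> B `<=` P' -> P' `<=` P -> P' = P) ->
  forall F : nat -> ideal R,
    (forall n, B `<=` F n) -> (forall n, F n.+1 `<=` F n) ->
  exists N, forall n x, (N <= n)%N -> F n x -> exists2 s, ~ P s & F n.+1 (s * x).
Proof.
move=> pP; have [nP1 pP'] := pP; move: B; elim/(noeth_ind noethR) => B IH Bmin F BF Fdesc.
have full n x s : ~ P s -> F n s -> exists2 s, ~ P s & F n (s * x).
  by move=> nPs Fs; exists s => //; apply: ideal_mulr.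
case: (pselect (B `<=` P)) => [BP|/not_sub[s [Bs nPs]]]; last first.
  by exists 0%N => n x _ _; apply: (full _ _ s) => //; apply: BF.
have Fle n k x : F (n + k)%N x -> F n x.
  elim: k => [|k IHk]; first by rewrite addn0.
  by rewrite addnS => /(Fdesc _ _)/IHk.
(* A prime [B] equals [P] by minimality. Then either the chain enters [P] and stays equal to it, or
   every term is locally the unit ideal. *)
case: (pselect (prime_ideal B)) => [pB|nB].
  have {}BP : B = P by apply: Bmin.
  case: (pselect (exists N, F N `<=` P)) => [[N FN]|nF].
    exists N => n x Nn Fx; exists 1; rewrite ?mul1r //; apply: (BF n.+1).
    by rewrite BP; apply: FN; apply: (@Fle N (n - N)%N); rewrite subnKC.
  exists 0%N => n x _ _; have [|s [Fs nPs]] := @not_sub _ (F n.+1) P.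
    by move=> FP; apply: nF; exists n.+1.
  exact: full Fs.
have [x [y [Bxy nBx nBy]]] : exists x y, [/\ B (x * y), ~ B x & ~ B y].
  apply: contrapT => nxy; apply: nB; split; first by move/BP.
  move=> x y Bxy; apply: contrapT => /not_orP[nBx nBy].
  by apply: nxy; exists x, y.
have Bmono C : B `<=` C ->
    (forall P' : ideal R, prime_ideal P' -> C `<=` P' -> P' `<=` P -> P' = P).
  by move=> BC P' pP2 CP'; apply: Bmin => // z /BC /CP'.
(* The chains [F n + (x)] and [F n : x] lie over the larger ideals [B + (x)] and [B : x], where the
   induction applies; together they control [F n]. *)
have [N1 stab1] : exists N, forall n z, (N <= n)%N -> adjoin (F n) x z ->
    exists2 s, ~ P s & adjoin (F n.+1) x (s * z).
  apply: (IH (adjoin B x)) => [||n|n].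
  - exact: proper_adjoin.
  - by apply: Bmono; apply: sub_adjoin.
  - apply: adjoin_min; last exact: adjoin_gen.
    by move=> z Bz; apply: sub_adjoin; apply: BF.
  - apply: adjoin_min; last exact: adjoin_gen.
    by move=> z Fz; apply: sub_adjoin; apply: Fdesc.
have [N2 stab2] : exists N, forall n z, (N <= n)%N -> quotient_elt (F n) x z ->
    exists2 s, ~ P s & quotient_elt (F n.+1) x (s * z).
  have Bq : B `<=` quotient_elt B x by move=> z Bz; apply: ideal_mulr.
  apply: (IH (quotient_elt B x)) => [||n z|n z].
  - split=> // qB; apply: nBy; apply: qB.
    by rewrite /= mulrC.
  - exact: Bmono.
  - exact: BF.
  - exact: Fdesc.
exists (N1 + N2)%N => n z Nn Fz.
have [|s nPs [c [r [Fc E]]]] := stab1 n z _ (sub_adjoin _ Fz).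
  exact: leq_trans (leq_addr _ _) Nn.
have [||s' nPs' Fs'] := stab2 n r _ _.
- exact: leq_trans (leq_addl _ _) Nn.
- rewrite /ideal_has /=; have -> : r * x = s * z - c by rewrite E addrC addKr.
  by apply: idealB; [exact: ideal_mull | exact: Fdesc].
exists (s' * s); first by move=> /pP'[].
by rewrite -mulrA E mulrDr mulrA; apply: idealD; [exact: ideal_mull|].
Qed.

(** This set is the contraction to R of the extension of [P + (y ^+ n)] to the localization at [Q];
    it takes the place of the symbolic powers of [Q] in the classical proof. *)
Lemma local_power_closed P Q y : prime_ideal Q ->
  forall n, ideal_closed [set r | exists s, ~ Q s /\ adjoin P (y ^+ n) (s * r)].
Proof.
move=> [nQ1 pQ] n; split.
  by exists 1; split=> //; rewrite mulr0; apply: ideal0.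
move=> a u v [s [nQs Ps]] [s' [nQs' Ps']]; exists (s * s').
split; first by move=> /pQ[].
have -> : s * s' * (a * u + v) = (s' * a) * (s * u) + s * (s' * v) by ring.
by apply: idealD; apply: ideal_mull.
Qed.

(** Otherwise [P] is minimal over [P0 + (t)], and the ideals [S n + (t)] stabilize locally at [P].
    As [t] is outside [Q], Nakayama's lemma removes [t], so [S N] and [S N.+1] agree locally at [P];
    this fails for [y] in [Q] outside [P0]. *)
Lemma krull_principal_ideal P0 Q P t :
  prime_ideal P0 -> prime_ideal Q -> prime_ideal P ->
  P0 `<` Q -> Q `<` P -> P t ->
  exists P', [/\ prime_ideal P', P0 `<=` P', P' t & P' `<` P].
Proof.
move=> pP0 pQ pP [P0Q nQP0] [QP nPQ] Pt; apply: contrapT => nex.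
have minP P' : prime_ideal P' -> adjoin P0 t `<=` P' -> P' `<=` P -> P' = P.
  move=> pP' P0tP' P'P; apply: contrapT => nP'P; apply: nex; exists P'; split=> //.
  - by move=> z P0z; apply: P0tP'; apply: sub_adjoin.
  - by apply: P0tP'; apply: adjoin_gen.
  - exact: proper_sub.
have nQt : ~ Q t.
  move=> Qt; apply: nPQ; rewrite (minP Q) //.
  exact: adjoin_min.
have [y [Qy nP0y]] := not_sub nQP0.
pose S n : ideal R := Ideal (local_power_closed P0 y pQ n).
have SS n : S n.+1 `<=` S n.
  move=> r [s [nQs]] [a [c [P0a E]]]; exists s; split=> //.
  by exists a, (c * y); rewrite E exprS mulrA.
have P0S n : P0 `<=` S n.
  move=> r P0r; exists 1; split; first exact: (proj1 pQ).
  by rewrite mul1r; apply: sub_adjoin.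
have [||N stab] := descending_stabilizes pP minP (F := fun n => adjoin (S n) t).
- move=> n; apply: adjoin_min; last exact: adjoin_gen.
  by move=> z P0z; apply: sub_adjoin; apply: P0S.
- move=> n; apply: adjoin_min; last exact: adjoin_gen.
  by move=> z Sz; apply: sub_adjoin; apply: SS.
have [k Sk|e nPe eS] := nakayama (A := S N.+1) (K := S N) pP Pt.
  have [|s nPs [a [r [Sa E]]]] := stab N k (leqnn _); first exact: sub_adjoin.
  exists s, a, r; split=> //; last by rewrite E [r * t]mulrC.
  have [s' [nQs' P0s']] : S N (r * t).
    have -> : r * t = s * k - a by rewrite E addrC addKr.
    by apply: idealB; [exact: ideal_mull | exact: SS].
  exists (s' * t); split; first by move=> /(proj2 pQ)[].
  by rewrite -mulrA [t * r]mulrC.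
have [s [nQs [a [r [P0a E]]]]] : S N.+1 (e * y ^+ N).
  apply: eS; exists 1; split; first exact: (proj1 pQ).
  by rewrite mul1r; apply: adjoin_gen.
have nP0yN n : ~ P0 (y ^+ n).
  elim: n => [|n IH]; first by rewrite expr0; case: pP0.
  by rewrite exprS => /(proj2 pP0)[].
(* Modulo the prime [P0] the power of [y] cancels, so [s * e - r * y] is in [P0]; as [y] is in [Q]
   and [s] is not, [e] falls into [Q], hence into [P]. *)
have : P0 ((s * e - r * y) * y ^+ N).
  have -> // : (s * e - r * y) * y ^+ N = a.
  by rewrite mulrBl -mulrA E exprS -!mulrA addrK.
case/(proj2 pP0) => [|/nP0yN //] /P0Q /ideal_subr Qse.
have /(proj2 pQ)[|/QP] // : Q (s * e) by apply: Qse; apply: ideal_mull.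
Qed.

(** Chains with [k] strict inclusions, in a recursive form that allows surgery at the bottom;
    primality is asked of the members above [P]. *)
Fixpoint chain_to (k : nat) P Q : Prop :=
  if k is k'.+1 then exists P', [/\ prime_ideal P', P `<` P' & chain_to k' P' Q]
  else P = Q.

Lemma chain_to_sub k P Q : chain_to k P Q -> P `<=` Q.
Proof.
elim: k P => [P -> //|k IH] P [P' [_ [PP' _] /IH P'Q]].
by move=> x /PP' /P'Q.
Qed.

Lemma chain_to_cat k n P P' Q :
  chain_to k P P' -> chain_to n P' Q -> chain_to (k + n) P Q.
Proof.
elim: k P => [P -> //|k IH] P [P1 [pP1 PP1 P1P']] P'Q.
by exists P1; split=> //; apply: IH.
Qed.

(** The element [t] is pushed down from the top: if [P1] lacks it, induction gives a prime [P2]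
    above [P1] that contains it, and Krull's theorem replaces [P1] by a prime containing [t]. *)
Lemma chain_to_adjoin k P Q t : prime_ideal P -> chain_to k.+1 P Q -> Q t ->
  exists P', [/\ prime_ideal P', adjoin P t `<=` P' & chain_to k P' Q].
Proof.
elim: k P => [|k IH] P pP [P1 [pP1 [PP1 nP1P] P1Q]] Qt.
  by exists P1; split=> //; rewrite P1Q in PP1 *; apply: adjoin_min.
case: (pselect (P1 t)) => [P1t|nP1t].
  by exists P1; split=> //; apply: adjoin_min.
have [P2 [pP2 P1P2 P2Q]] := IH P1 pP1 P1Q Qt.
have [||P' [pP' PP' P't P'P2]] := krull_principal_ideal (t := t) pP pP1 pP2 (conj PP1 nP1P).
- split; first by move=> z P1z; apply: P1P2; apply: sub_adjoin.
  by move=> /(_ t)P2P1; apply: nP1t; apply: P2P1; apply: P1P2; apply: adjoin_gen.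
- by apply: P1P2; apply: adjoin_gen.
exists P'; split=> //; first exact: adjoin_min.
by exists P2.
Qed.

(** Krull's height theorem: each generator in [l] is absorbed at the cost of one step, which would
    leave a strict inclusion from a prime containing [Q] up to [Q]. *)
Lemma chain_to_adjoins A (l : seq R) P Q : Q = adjoins A l ->
  A `<=` P -> prime_ideal P -> ~ chain_to (size l).+1 P Q.
Proof.
elim: l A P => [|t l IH] A P QE AP pP.
  by move=> [P' [_ [PP' nP'P] QP']]; apply: nP'P; rewrite QP' QE.
move=> /(chain_to_adjoin (t := t) pP)[|P' [pP' PP' P'Q]].
  by rewrite QE; apply: adjoins_gen; rewrite inE eqxx.
apply: (IH (adjoin A t) P') => // z [a [r [Aa ->]]].
by apply: PP'; exists a, r; split=> //; apply: AP.
Qed.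

End Krull.

(** * Exchange of regular elements *)

Section Colon.
Variable R : comNzRingType.
Implicit Types (A B H I J K P Q : ideal R) (r s t u w x y : R).

(** The half of the permutability of regular sequences that holds in every commutative ring;
    [local_nzd_swap] is the other half. *)
Lemma nzd_adjoin_swap A x y : nzd A x -> nzd (adjoin A x) y -> nzd (adjoin A y) x.
Proof.
move=> nx ny w [a [r [Aa E]]].
have [b [s [Ab E']]] : adjoin A x r.
  apply: ny; exists (- a), w; split; first exact: idealN.
  by rewrite [w * x]mulrC E; ring.
exists (w - s * y), s; split; last by ring.
apply: nx; have -> : x * (w - s * y) = a + b * y by rewrite mulrBr E E'; ring.
by apply: idealD => //; apply: ideal_mulr.
Qed.

(** Modulo [A], [v] is [u] times the fraction [c / b], and this fraction maps (b) into (c). *)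
Lemma adjoin_cross A b c u v : nzd A b -> A (b * v - c * u) ->
  forall h, adjoin A b (h * u) -> adjoin A c (h * v).
Proof.
move=> nb Abc h [a [r [Aa E]]].
exists (h * v - r * c), r; split; last by ring.
apply: nb; have -> : b * (h * v - r * c) = h * (b * v - c * u) + c * a.
  have -> : a = h * u - r * b by rewrite E addrK.
  by ring.
by apply: idealD; apply: ideal_mull.
Qed.

(** Hom(R/H, R/(A+(b))) and Hom(R/H, R/(A+(c))) are both Ext^1(R/H, R/A), so they vanish together;
    the proof writes the isomorphism as multiplication by a fraction. *)
Lemma assoc_free_change A H b c : nzd A b -> nzd A c -> H b -> H c ->
  (forall u, (forall h, H h -> adjoin A b (h * u)) -> adjoin A b u) ->
  (forall u, (forall h, H h -> adjoin A c (h * u)) -> adjoin A c u).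
Proof.
move=> nb nc Hb Hc free v cv.
have [a [u [Aa E]]] := cv b Hb.
have [d [w [Ad E']]] : adjoin A b u.
  apply: free => h Hh; apply: (adjoin_cross (u := v) nc); last exact: cv.
  have -> : c * u - b * v = - a by rewrite E; ring.
  exact: idealN.
exists (v - w * c), w; split; last by ring.
apply: nb; have -> : b * (v - w * c) = a + d * c by rewrite mulrBr E E'; ring.
by apply: idealD => //; apply: ideal_mulr.
Qed.

End Colon.

(** * Depth, associated primes and regular parameters in a Noetherian local ring *)

Section Local.
Variables (R : comNzRingType) (m : ideal R).
Hypotheses (noethR : noetherian R) (pm : prime_ideal m).
Hypothesis unit_out : forall r, ~ m r -> exists s, s * r = 1.
Implicit Types (A B C H I J K P Q : ideal R) (r s t u w x y : R).

Lemma local_nakayama t A K : m t ->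
  (forall k, K k -> exists a k', [/\ A a, K k' & k = a + t * k']) -> K `<=` A.
Proof.
move=> mt KA k Kk.
have [k' Kk'|e /unit_out[s se] /(_ k Kk) Aek] := nakayama noethR (A := A) (K := K) pm mt.
  have [a [k2 [Aa Kk2 E]]] := KA k' Kk'.
  by exists 1, a, k2; split=> //; [case: pm | rewrite mul1r].
by rewrite -[k]mul1r -se -mulrA; apply: ideal_mull.
Qed.

Lemma proper_sub_max A : is_proper A -> A `<=` m.
Proof.
move=> nA1 x Ax; apply: contrapT => /unit_out[s sx].
by apply: nA1; rewrite -sx; apply: ideal_mull.
Qed.

(** For [K = A : y] the hypotheses put [K] inside [A + x K], and Nakayama's lemma applies. *)
Lemma local_nzd_swap A x y : m x -> nzd A x -> nzd (adjoin A x) y -> nzd A y.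
Proof.
move=> mx nx ny w Ayw.
apply: (@local_nakayama x A (quotient_elt A y)) => //; last first.
  by rewrite /= mulrC.
move=> k Ak; have [a [r [Aa E]]] : adjoin A x k.
  by apply: ny; apply: sub_adjoin; rewrite mulrC.
exists a, r; split=> //; last by rewrite E mulrC.
apply: nx; have -> : x * (r * y) = k * y - a * y by rewrite E; ring.
by apply: idealB => //; apply: ideal_mulr.
Qed.

(** Depth of R/A at least [k]. For the unit ideal it holds for all [k]: the zero module has infinite
    depth. *)
Fixpoint depth_ge (k : nat) A : Prop :=
  if k is k'.+1 then exists t, [/\ m t, nzd A t & depth_ge k' (adjoin A t)]
  else True.

(** Any regular element may open the sequence. An [e] regular modulo both [A + (t)] and [A + (c)]
    mediates: the induction is used over [A + (t)] with [e], then over [A + (e)] with [c]. *)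
Lemma depth_ge_adjoin k A c : depth_ge k.+1 A -> m c -> nzd A c ->
  depth_ge k (adjoin A c).
Proof.
elim: k A c => [|k IH] A c; first by [].
move=> [t [mt nt dt]] mc nc.
have [s [ms ns _]] := dt.
have freet u : (forall h, m h -> adjoin A t (h * u)) -> adjoin A t u.
  by move=> mu; apply: ns; apply: mu.
have freec := assoc_free_change nt nc mt mc freet.
have [u _ mu|u _ mu|e me] := @nzd_avoidance _ noethR (adjoin A t) (adjoin A c) m 0.
- exact: freet.
- exact: freec.
rewrite add0r => -[net nec].
have ne : nzd A e by apply: local_nzd_swap net.
exists e; split=> //; rewrite adjoinAC; apply: (IH _ _) => //.
  exists t; split=> //; first exact: nzd_adjoin_swap net.
  by rewrite adjoinAC; apply: (IH _ _).
exact: nzd_adjoin_swap nec.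
Qed.

(** This gives depth R/A <= dim R/P for [P = A : u]. By Nakayama some [w] killed by [P] modulo [A]
    is outside [A + (t)]; a prime associated to [A + (t)] above the annihilator of [w] contains [P],
    and also [t], which is not in [P]. *)
Lemma chain_from_assoc k A u : depth_ge k A -> prime_ideal (quotient_elt A u) ->
  exists M, chain_to k (quotient_elt A u) M.
Proof.
elim: k A u => [|k IH] A u; first by move=> _ _; exists (quotient_elt A u).
move=> [t [mt nt dt]] pu; set P := quotient_elt A u in pu *.
have nAu : ~ A u by move=> Au; apply: (proj1 pu); rewrite /P /ideal_has /= mul1r.
have [w [Pw nAtw]] : exists w, (forall h, P h -> A (h * w)) /\ ~ adjoin A t w.
  apply: contrapT => nex; apply: nAu.
  have cl : ideal_closed [set w | forall h, P h -> A (h * w)].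
    split=> [h _|a x y /= Ax Ay h Ph]; first by rewrite mulr0; apply: ideal0.
    by rewrite mulrDr mulrCA; apply: idealD; [apply: ideal_mull; apply: Ax|apply: Ay].
  apply: (@local_nakayama t A (Ideal cl)) => //.
  move=> k' Ak'; have [a [r [Aa E]]] : adjoin A t k'.
    by apply: contrapT => nAk'; apply: nex; exists k'.
  exists a, r; split=> //; last by rewrite E mulrC.
  move=> h Ph; apply: nt.
  have -> : t * (h * r) = h * k' - h * a by rewrite E; ring.
  by apply: idealB; [exact: Ak' | exact: ideal_mull].
have [|v [nv pv wv vt]] := zero_divisor_assoc noethR (w := t) nAtw.
  by rewrite mulrC; apply: ideal_mull; apply: adjoin_gen.
have [M vM] := IH _ _ dt pv; exists M, (quotient_elt (adjoin A t) v); split=> //.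
split; first by move=> h Ph; apply: wv; apply: sub_adjoin; apply: Pw.
by move=> /(_ t vt) /nt.
Qed.

(** By induction [A + (t)] and [P + (t)] are prime. The height theorem forces [P + (t)] into
    [A + (t)] and [t] out of [P], so each [p] in [P] is [a + r * t] with [r] in [P], and Nakayama's
    lemma gives [P = A]. *)
Lemma regular_parameters k A P (l : seq R) : size l = k ->
  prime_ideal P -> A `<=` P -> chain_to k P m -> m = adjoins A l ->
  prime_ideal A /\ depth_ge k A.
Proof.
elim: k A P l => [|k IH] A P [|t l] //=; first by move=> _ _ _ _ <-.
move=> [sl] pP AP Pm mE.
have mt : m t by rewrite mE; apply: sub_adjoins; apply: adjoin_gen.
have [P' [pP' PP' P'm]] := chain_to_adjoin noethR pP Pm mt.
have AP' : adjoin A t `<=` P'.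
  by apply: adjoin_min => [z /AP Pz|]; apply: PP'; [apply: sub_adjoin | apply: adjoin_gen].
have mE' : m = adjoins (adjoin P t) l.
  apply: ideal_anti => [z|].
    rewrite {1}mE; apply: adjoins_min => [y|y yl]; last exact: adjoins_gen.
    by move=> [a [r [Aa ->]]]; apply: sub_adjoins; exists a, r; split=> //; apply: AP.
  apply: adjoins_min => [z /PP'|y yl]; first exact: chain_to_sub P'm z.
  by rewrite mE; apply: adjoins_gen.
have [pB dB] := IH _ _ _ sl pP' AP' P'm mE.
have [pC _] := IH _ _ _ sl pP' PP' P'm mE'.
have nochain Q : adjoin A t `<=` Q -> prime_ideal Q -> ~ chain_to k.+1 Q m.
  by move=> AQ pQ; rewrite -sl; apply: (chain_to_adjoins noethR mE AQ pQ).
(* Otherwise [P'] is strictly above [A + (t)], giving a chain of length [k.+1] to [m], which has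
   only [k] generators over [A + (t)]. *)
have BC : adjoin P t `<=` adjoin A t.
  move=> z Cz; apply: contrapT => nBz; apply: (@nochain (adjoin A t)) => //.
  exists P'; split=> //; split=> // /(_ z) P'B; apply: nBz; apply: P'B.
  exact: PP'.
have nPt : ~ P t.
  by move=> Pt; apply: (@nochain P) => //; apply: adjoin_min.
have eAP : P = A.
  apply: ideal_anti => //; apply: (local_nakayama mt) => p Pp.
  have [a [r [Aa E]]] := BC p (sub_adjoin _ Pp).
  exists a, r; split=> //; last by rewrite E mulrC.
  have [|//|//] := (proj2 pP) r t.
  by have -> : r * t = p - a; [rewrite E addrC addKr | apply: idealB => //; apply: AP].
rewrite -eAP in dB *; split=> //; exists t; split=> //.
exact: prime_nzd.
Qed.

End Local.

(** * Exact sequences and bounds on projective dimension *)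

Section Modules.
Variable R : comNzRingType.
Implicit Types (U V A B C M N P Q X : lmodType R).

Definition linear_of U V (f : U -> V) (lf : linear f) : {linear U -> V} :=
  HB.pack_for {linear U -> V} f (GRing.isLinear.Build R U V *:%R f lf).

Definition ker_pred U V (f : {linear U -> V}) : {pred U} := fun x => f x == 0.

Fact ker_pred_closed U V (f : {linear U -> V}) : submod_closed (ker_pred f).
Proof.
split=> [|a x y]; rewrite !unfold_in ?linear0 // => /eqP fx /eqP fy.
by rewrite linearP fx fy scaler0 addr0.
Qed.

HB.instance Definition _ U V (f : {linear U -> V}) :=
  GRing.isSubmodClosed.Build R U (ker_pred f) (ker_pred_closed f).

Definition kernel U V (f : {linear U -> V}) : Type := {x : U | x \in ker_pred f}.

HB.instance Definition _ U V (f : {linear U -> V}) := SubChoice.on (kernel f).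
HB.instance Definition _ U V (f : {linear U -> V}) :=
  [SubChoice_isSubLmodule of kernel f by <:].

(** Opaque, so that [kernel_val] is used only through its injectivity and its image. *)
Lemma kernel_inclusion U V (f : {linear U -> V}) :
  {i : {linear kernel f -> U} |
    injective i /\ forall x, f x = 0 <-> exists k, i k = x}.
Proof.
exists (val : {linear kernel f -> U}); split; first exact: val_inj.
move=> x; split=> [fx|[k <-]]; last by have := valP k; rewrite unfold_in => /eqP.
have kx : x \in ker_pred f by rewrite unfold_in fx.
by exists (exist _ x kx).
Qed.

Definition kernel_val U V (f : {linear U -> V}) := sval (kernel_inclusion f).

Lemma kernel_val_inj U V (f : {linear U -> V}) : injective (kernel_val f).
Proof. exact: (proj1 (svalP (kernel_inclusion f))). Qed.

Lemma kernelP U V (f : {linear U -> V}) x :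
  f x = 0 <-> exists k, kernel_val f k = x.
Proof. exact: (proj2 (svalP (kernel_inclusion f))). Qed.

Lemma kernel_val0 U V (f : {linear U -> V}) k : f (kernel_val f k) = 0.
Proof. by apply/kernelP; exists k. Qed.

Lemma lift_inj A B X (i : {linear A -> B}) (f : {linear X -> B}) :
  injective i -> (forall x, exists a, i a = f x) ->
  exists g : {linear X -> A}, forall x, i (g x) = f x.
Proof.
move=> inj_i /choice[g gE].
have lg : linear g by move=> a x y; apply: inj_i; rewrite linearP !gE linearP.
by exists (linear_of lg).
Qed.

Lemma lift_kernel U V X (f : {linear U -> V}) (g : {linear X -> U}) :
  (forall x, f (g x) = 0) ->
  exists h : {linear X -> kernel f}, forall x, kernel_val f (h x) = g x.
Proof.
move=> fg; apply: lift_inj; first exact: kernel_val_inj.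
by move=> x; apply/kernelP.
Qed.

Definition short_exact A B C (f : {linear A -> B}) (g : {linear B -> C}) : Prop :=
  [/\ injective f, forall c, exists b, g b = c
    & forall b, g b = 0 <-> exists a, f a = b].

Lemma linear_pair U V X (f : {linear X -> U}) (g : {linear X -> V}) :
  linear (fun x => (f x, g x)).
Proof. by move=> a x y; rewrite !linearP. Qed.

Lemma linear_copair U V X (f : {linear U -> X}) (g : {linear V -> X}) :
  linear (fun u : U * V => f u.1 + g u.2).
Proof.
by move=> a x y /=; rewrite !linearP scalerDr addrACA.
Qed.

Lemma linear_fst U V : linear (@fst U V). Proof. by []. Qed.
Lemma linear_snd U V : linear (@snd U V). Proof. by []. Qed.

Lemma linear_inl U V : linear (fun u : U => (u, 0 : V)).
Proof. by move=> a x y; congr (_, _); rewrite /= scaler0 addr0. Qed.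

Lemma linear_inr U V : linear (fun v : V => (0 : U, v)).
Proof. by move=> a x y; congr (_, _); rewrite /= scaler0 addr0. Qed.

Lemma projective_retract P Q (i : {linear Q -> P}) (r : {linear P -> Q}) :
  cancel i r -> projective P -> projective Q.
Proof.
move=> ir pP A B g f gsurj; have [h hE] := pP A B g (f \o r) gsurj.
by exists (h \o i) => x; rewrite /= hE /= ir.
Qed.

Lemma projective_prod P Q : projective P -> projective Q ->
  projective (P * Q)%type.
Proof.
move=> pP pQ A B g f gsurj.
have [h1 h1E] := pP A B g (f \o linear_of (@linear_inl P Q)) gsurj.
have [h2 h2E] := pQ A B g (f \o linear_of (@linear_inr P Q)) gsurj.
exists (linear_of (linear_copair h1 h2)) => -[p q].
rewrite /= linearD h1E h2E /= -linearD; congr (f _).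
by congr (_, _); rewrite /= ?addr0 ?add0r.
Qed.

Lemma projective0 P : (forall x : P, x = 0) -> projective P.
Proof.
move=> P0 A B g f _.
have l0 : linear (fun _ : P => 0 : A) by move=> a x y; rewrite scaler0 addr0.
by exists (linear_of l0) => x; rewrite (P0 x) !linear0.
Qed.

Lemma projective_section P B (g : {linear B -> P}) : projective P ->
  (forall c, exists b, g b = c) -> exists s : {linear P -> B}, cancel s g.
Proof. by move=> pP /(pP _ _ g idfun)[s sE]; exists s. Qed.

Lemma short_exact_retraction A B C (f : {linear A -> B}) (g : {linear B -> C})
    (s : {linear C -> B}) : short_exact f g -> cancel s g ->
  exists r : {linear B -> A}, (forall b, f (r b) = b - s (g b)) /\ cancel f r.
Proof.
move=> [finj gsurj fg] sg.
have lh : linear (fun b => b - s (g b)).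
  by move=> a x y; rewrite [g _]linearP [s _]linearP scalerBr opprD addrACA.
have [|r rE] := lift_inj (f := linear_of lh) finj.
  by move=> b; apply/fg; rewrite /= linearB sg subrr.
exists r; split=> // a; apply: finj; rewrite rE /=.
have -> : g (f a) = 0 by apply/fg; exists a.
by rewrite linear0 subr0.
Qed.

Lemma projective_extension A B C (f : {linear A -> B}) (g : {linear B -> C}) :
  short_exact f g -> projective A -> projective C -> projective B.
Proof.
move=> ex pA pC; have [finj gsurj fg] := ex.
have [s sg] := projective_section pC gsurj.
have [r [rE _]] := short_exact_retraction ex sg.
apply: (@projective_retract (A * C)%type B (linear_of (linear_pair r g))
  (linear_of (linear_copair f s))); last exact: projective_prod.
by move=> b /=; rewrite rE subrK.
Qed.

Lemma projective_kernel A B C (f : {linear A -> B}) (g : {linear B -> C}) :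
  short_exact f g -> projective B -> projective C -> projective A.
Proof.
move=> ex pB pC; have [finj gsurj fg] := ex.
have [s sg] := projective_section pC gsurj.
have [r [_ fr]] := short_exact_retraction ex sg.
exact: projective_retract fr pB.
Qed.

(** Projective dimension at most [n], by recursion on the first syzygy, a form suited to induction
    along exact sequences; [pd_le_has_proj_res] and [has_proj_res_pd_le] relate it to
    resolutions. *)
Fixpoint pd_le n M : Prop :=
  if n is n'.+1 then
    exists (P : lmodType R) (g : {linear P -> M}),
      [/\ projective P, forall y, exists x, g x = y & pd_le n' (kernel g)]
  else projective M.

Lemma kernel_map_exact B C N (f : {linear B -> C}) (k : {linear N -> B}) :
  (forall x, f (k x) = 0) ->
  exists h : {linear N -> kernel f}, [/\ forall x, kernel_val f (h x) = k x,
    injective k -> injective h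
    & (forall b, f b = 0 -> exists x, k x = b) -> forall y, exists x, h x = y].
Proof.
move=> fk; have [h hE] := lift_kernel fk; exists h; split=> // [kinj x y hxy|ksurj y].
  by apply: kinj; rewrite -!hE hxy.
have [x kx] := ksurj _ (kernel_val0 y).
by exists x; apply: (@kernel_val_inj _ _ f); rewrite hE.
Qed.

Lemma pd_le_iso n A B (f : {linear A -> B}) : injective f ->
  (forall b, exists a, f a = b) -> pd_le n A -> pd_le n B.
Proof.
elim: n A B f => [|n IH] A B f finj fsurj.
  have [|r fr] := lift_inj (f := idfun : {linear B -> B}) finj; first exact: fsurj.
  exact: (projective_retract (i := r) (r := f)).
move=> [P [g [pP gsurj pd]]]; exists P, (f \o g); split=> //.
  by move=> b; have [a <-] := fsurj b; have [x <-] := gsurj a; exists x.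
have fg0 x : f (g (kernel_val g x)) = 0 by rewrite kernel_val0 linear0.
have [h [_ hinj hsurj]] := kernel_map_exact (f := f \o g) (k := kernel_val g) fg0.
apply: IH (hinj (@kernel_val_inj _ _ _)) (hsurj _) pd => b /= fgb.
by apply/kernelP; apply: finj; rewrite fgb linear0.
Qed.

Lemma pd_le_presentation n A B C (f : {linear A -> B}) (g : {linear B -> C}) :
  short_exact f g -> projective B -> pd_le n A -> pd_le n.+1 C.
Proof.
move=> [finj gsurj fg] pB pA; exists B, g; split=> //.
have [|h [_ hinj hsurj]] := kernel_map_exact (f := g) (k := f).
  by move=> x; apply/fg; exists x.
by apply: pd_le_iso (hinj finj) (hsurj _) pA => b /fg.
Qed.

Lemma kernel_short_exact B C (g : {linear B -> C}) :
  (forall c, exists b, g b = c) -> short_exact (kernel_val g) g.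
Proof. by move=> gsurj; split; [exact: kernel_val_inj | | exact: kernelP]. Qed.

Lemma pd_leS n M : pd_le n M -> pd_le n.+1 M.
Proof.
elim: n M => [|n IH] M; last first.
  by move=> [P [g [pP gsurj pK]]]; exists P, g; split=> //; apply: IH.
move=> pM; exists M, idfun; split=> // [y|]; first by exists y.
apply: projective0 => x; apply: (@kernel_val_inj _ _ idfun).
by rewrite linear0; apply: (@kernel_val0 _ _ idfun).
Qed.

Lemma pd_le_leq n k M : (n <= k)%N -> pd_le n M -> pd_le k M.
Proof.
move=> /subnKC <-; elim: (k - n)%N => [|i IH]; first by rewrite addn0.
by move=> /IH /pd_leS; rewrite addnS.
Qed.

(** Horseshoe lemma: [P * Q] covers [B] once [v] is lifted through [g], and the three kernels form a
    short exact sequence for the induction. *)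
Lemma pd_le_extension n A B C (f : {linear A -> B}) (g : {linear B -> C}) :
  short_exact f g -> pd_le n A -> pd_le n C -> pd_le n B.
Proof.
elim: n A B C f g => [|n IH] A B C f g ex; first exact: projective_extension ex.
move=> [P [u [pP usurj pdu]]] [Q [v [pQ vsurj pdv]]].
have [finj gsurj fg] := ex.
have [h hE] := pQ _ _ g v gsurj.
pose w := linear_of (linear_copair (f \o u) h).
have gf a : g (f a) = 0 by apply/fg; exists a.
have gw p q : g (w (p, q)) = v q by rewrite /w /= linearD gf add0r hE.
have wsurj b : exists pq, w pq = b.
  have [q vq] := vsurj (g b).
  have /fg[a fa] : g (b - h q) = 0 by rewrite linearB hE vq subrr.
  by have [p up] := usurj a; exists (p, q); rewrite /w /= up fa subrK.
exists (P * Q)%type, w; split=> //; first exact: projective_prod.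
pose i := linear_of (@linear_inl P Q) \o kernel_val u.
have wi x : w (i x) = 0 by rewrite /w /= kernel_val0 !linear0 addr0.
have [i' [i'E i'inj _]] := kernel_map_exact (f := w) (k := i) wi.
pose j := linear_of (@linear_snd P Q) \o kernel_val w.
have vj x : v (j x) = 0.
  by rewrite /j /= -(gw (kernel_val w x).1) -surjective_pairing kernel_val0 linear0.
have [j' j'E] := lift_kernel (f := v) (g := j) vj.
apply: (IH _ _ _ i' j') => //; split.
- by apply: i'inj => x y /(congr1 fst) /kernel_val_inj.
- move=> c; have gh : g (h (kernel_val v c)) = 0 by rewrite hE kernel_val0.
  have [a fa] : exists a, f a = h (kernel_val v c) by apply/fg.
  have [p up] := usurj (- a).
  have [k kE] : exists k, kernel_val w k = (p, kernel_val v c).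
    by apply/kernelP; rewrite /w /= up linearN fa addNr.
  by exists k; apply: (@kernel_val_inj _ _ v); rewrite j'E /j /= kE.
move=> b; split=> [jb|[x <-]]; last first.
  by apply: (@kernel_val_inj _ _ v); rewrite j'E /j /= i'E linear0.
have b2 : (kernel_val w b).2 = 0.
  by have := j'E b; rewrite jb linear0 /j /= => <-.
have [x xE] : exists x, kernel_val u x = (kernel_val w b).1.
  apply/kernelP; apply: finj; rewrite linear0.
  have := kernel_val0 b; rewrite (surjective_pairing (kernel_val w b)) b2.
  by rewrite /w /= linear0 addr0.
exists x; apply: (@kernel_val_inj _ _ w); rewrite i'E /i /= xE.
by rewrite -b2 -surjective_pairing.
Qed.

(** The kernel of [g \o u] is projective because [C] is; it covers [A] with the same kernel as
    [u]. *)
Lemma pd_le_kernel_projective n A B C (f : {linear A -> B}) (g : {linear B -> C}) :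
  short_exact f g -> projective C -> pd_le n B -> pd_le n A.
Proof.
case: n => [|n] ex pC; first by move/(projective_kernel ex); apply.
have [finj gsurj fg] := ex; move=> [F [u [pF usurj pdu]]].
have gusurj c : exists x, (g \o u) x = c.
  by have [b <-] := gsurj c; have [x <-] := usurj b; exists x.
have pK : projective (kernel (g \o u)).
  exact: projective_kernel (kernel_short_exact gusurj) pF pC.
have [|v vE] := lift_inj (f := u \o kernel_val (g \o u)) finj.
  by move=> x; apply/fg; apply: (kernel_val0 (f := g \o u)).
have [|k [kE kinj _]] := kernel_map_exact (f := g \o u) (k := kernel_val u).
  by move=> x; rewrite /= kernel_val0 linear0.
apply: (pd_le_presentation (f := k) (g := v)) pdu => //; split.
- by apply: kinj; apply: kernel_val_inj.
- move=> a; have [x ux] := usurj (f a).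
  have [y yE] : exists y, kernel_val (g \o u) y = x.
    by apply/kernelP; rewrite /= ux; apply/fg; exists a.
  by exists y; apply: finj; rewrite vE /= yE.
move=> y; split=> [vy|[x <-]]; last first.
  by apply: finj; rewrite vE /= kE kernel_val0 linear0.
have [x xE] : exists x, kernel_val u x = kernel_val (g \o u) y.
  by apply/kernelP; have := vE y; rewrite vy linear0.
by exists x; apply: (@kernel_val_inj _ _ (g \o u)); rewrite kE.
Qed.

(** The kernel of the composite cover [g \o u] of [C] is an extension of [A] by the kernel of
    [u]. *)
Lemma pd_le_cokernel n A B C (f : {linear A -> B}) (g : {linear B -> C}) :
  short_exact f g -> pd_le n A -> pd_le n.+1 B -> pd_le n.+1 C.
Proof.
move=> [finj gsurj fg] pA [P [u [pP usurj pdu]]].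
have gusurj c : exists x, (g \o u) x = c.
  by have [b <-] := gsurj c; have [x <-] := usurj b; exists x.
apply: pd_le_presentation (kernel_short_exact gusurj) pP _.
have [|v vE] := lift_inj (f := u \o kernel_val (g \o u)) finj.
  by move=> x; apply/fg; apply: (kernel_val0 (f := g \o u)).
have [|k [kE kinj _]] := kernel_map_exact (f := g \o u) (k := kernel_val u).
  by move=> x; rewrite /= kernel_val0 linear0.
apply: (pd_le_extension (f := k) (g := v)) pdu pA; split.
- by apply: kinj; apply: kernel_val_inj.
- move=> a; have [x ux] := usurj (f a).
  have [y yE] : exists y, kernel_val (g \o u) y = x.
    by apply/kernelP; rewrite /= ux; apply/fg; exists a.
  by exists y; apply: finj; rewrite vE /= yE.
move=> y; split=> [vy|[x <-]]; last first.
  by apply: finj; rewrite vE /= kE kernel_val0 linear0.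
have [x xE] : exists x, kernel_val u x = kernel_val (g \o u) y.
  by apply/kernelP; have := vE y; rewrite vy linear0.
by exists x; apply: (@kernel_val_inj _ _ (g \o u)); rewrite kE.
Qed.

(** As in Schanuel's lemma, the pullback of [q] and [g], which is the kernel of [w], is an extension
    of [B] by the kernel of [q]; it also maps onto the projective [P] with kernel [A]. *)
Lemma pd_le_kernel n A B C (f : {linear A -> B}) (g : {linear B -> C}) :
  short_exact f g -> pd_le n B -> pd_le n.+1 C -> pd_le n A.
Proof.
move=> [finj gsurj fg] pB [P [q [pP qsurj pdq]]].
pose w := linear_of (linear_copair q (\- g)).
have wE p b : w (p, b) = q p - g b by [].
pose pr1 : {linear kernel w -> P} := linear_of (@linear_fst P B) \o kernel_val w.
pose pr2 : {linear kernel w -> B} := linear_of (@linear_snd P B) \o kernel_val w.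
have qg k : q (pr1 k) = g (pr2 k).
  apply/eqP; rewrite -subr_eq0; apply/eqP; have := kernel_val0 k.
  by rewrite {1}[kernel_val w k]surjective_pairing wE.
have kerw p b : q p = g b -> exists k, kernel_val w k = (p, b).
  by move=> E; apply/kernelP; rewrite wE E subrr.
have pX : pd_le n (kernel w).
  have [|i [iE iinj _]] :=
    kernel_map_exact (f := w) (k := linear_of (@linear_inl P B) \o kernel_val q).
    by move=> x; rewrite -[LHS]/(w (kernel_val q x, 0)) wE kernel_val0 linear0 subrr.
  apply: (pd_le_extension (f := i) (g := pr2)) pdq pB; split.
  - by apply: iinj => x y /(congr1 fst) /kernel_val_inj.
  - move=> b; have [p qp] := qsurj (g b).
    by have [k kE] := kerw p b qp; exists k; rewrite /pr2 /= kE.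
  move=> k; split=> [k2|[x <-]]; last by rewrite /pr2 /= iE.
  have [x xE] : exists x, kernel_val q x = pr1 k.
    by apply/kernelP; rewrite qg k2 linear0.
  exists x; apply: (@kernel_val_inj _ _ w); rewrite iE /= xE -k2.
  by rewrite -surjective_pairing.
have [|i [iE iinj _]] :=
  kernel_map_exact (f := w) (k := linear_of (@linear_inr P B) \o f).
  move=> x; rewrite -[LHS]/(w (0, f x)) wE linear0 sub0r; apply/eqP.
  by rewrite oppr_eq0; apply/eqP/fg; exists x.
apply: (pd_le_kernel_projective (f := i) (g := pr1)) pP pX; split.
- by apply: iinj => x y /(congr1 snd) /finj.
- move=> p; have [b gb] := gsurj (q p).
  by have [k kE] := kerw p b (esym gb); exists k; rewrite /pr1 /= kE.
move=> k; split=> [k1|[x <-]]; last by rewrite /pr1 /= iE.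
have [a aE] : exists a, f a = pr2 k by apply/fg; rewrite -qg k1 linear0.
exists a; apply: (@kernel_val_inj _ _ w); rewrite iE /= aE -k1.
by rewrite -surjective_pairing.
Qed.

Lemma pd_le_has_proj_res n M : pd_le n M -> has_proj_res M n.
Proof.
elim: n M => [|n IH] M.
  (* The zero module, placed in all positive degrees. *)
  move=> pM; pose Z : lmodType R := 'rV[R]_0.
  have Z0 (x : Z) : x = 0 by apply/matrixP => i [].
  have lZ U V : linear (fun _ : U => 0 : V) by move=> a x y; rewrite scaler0 addr0.
  exists (fun i => if i is _.+1 then Z else M), (fun i => linear_of (@lZ _ _)), idfun.
  split; last by case.
  split=> [[|i]|y|x|[|i] x] //.
  - exact: projective0.
  - by exists y.
  - by split=> [x0|[z <-] //]; exists 0; rewrite -[x]/(idfun x) x0.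
  - by split=> // _; exists 0; rewrite (Z0 x).
  - by split=> // _; exists 0; rewrite (Z0 x).
move=> [P [g [pP gsurj /IH[Q [d [e [[pQ esurj de dd] Q0]]]]]]].
pose S i : lmodType R := if i is j.+1 then Q j else P.
pose D i : {linear S i.+1 -> S i} :=
  match i with 0%N => kernel_val g \o e | j.+1 => d j end.
exists S, D, g; split; last by case=> // i; rewrite ltnS; apply: Q0.
split=> [[|i]|y|x|[|i] x] //.
- exact: pQ.
- apply: (iff_trans (kernelP _ _)); split=> [[k <-]|[z <-]]; last by exists (e z).
  by have [z <-] := esurj k; exists z.
- apply: iff_trans (de x); split=> [k0|ex0]; last by rewrite /= ex0 linear0.
  by apply: (@kernel_val_inj _ _ g); rewrite linear0.
exact: dd.
Qed.

Lemma has_proj_res_pd_le n M : has_proj_res M n -> pd_le n M.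
Proof.
elim: n M => [|n IH] M [P [d [e [[pP esurj de dd] P0]]]].
  apply: (@pd_le_iso 0 _ _ e) => //; last exact: pP.
  move=> x y exy.
  have /de[z dz] : e (x - y) = 0 by rewrite linearB exy subrr.
  have z0 : z = 0 by apply: (P0 1%N).
  by apply/eqP; rewrite -subr_eq0 -dz z0 linear0.
exists (P 0%N), e; split=> //; apply: IH.
have [|h [hE _ hsurj]] := kernel_map_exact (f := e) (k := d 0%N).
  by move=> x; apply/de; exists x.
exists (fun i => P i.+1), (fun i => d i.+1), h; split; last by move=> i ni; apply: (P0 i.+1).
split=> // [y|x]; first by apply: hsurj => b /de.
rewrite -dd -hE; split=> [->|k0]; first by rewrite linear0.
by apply: (@kernel_val_inj _ _ e); rewrite linear0.
Qed.

End Modules.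

(** * Cyclic modules and the transfer of bounds between linked ideals *)

Section QuotientModules.
Variable R : comNzRingType.
Implicit Types (A B I J L : ideal R) (M : lmodType R) (r u v w x y z : R).

Lemma quot_projZ A r x : r *: quot_proj A x = quot_proj A (r * x).
Proof. exact: quot_scale_proj. Qed.

Lemma quot_proj0 A x : quot_proj A x = 0 <-> A x.
Proof.
have p0 : quot_proj A 0 = 0.
  by apply: (addrI (quot_proj A 0)); rewrite -quot_projD !addr0.
by rewrite -[0 in X in X <-> _]p0; apply: (iff_trans (quot_proj_eq _ _ _)); rewrite subr0.
Qed.

Lemma quot_projP A (q : quot_mod A) : exists x, quot_proj A x = q.
Proof. by eexists; apply: quot_projK. Qed.

Lemma quot_proj_sum A (n : nat) (F : 'I_n -> R) :
  quot_proj A (\sum_i F i) = \sum_i quot_proj A (F i).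
Proof.
apply: big_morph; first exact: quot_projD.
by apply/quot_proj0; apply: ideal0.
Qed.

Lemma quot_map A M (e : M) : (forall r, A r -> r *: e = 0) ->
  exists g : {linear quot_mod A -> M}, forall r, g (quot_proj A r) = r *: e.
Proof.
move=> Ae.
have [g gE] : exists g : quot_mod A -> M, forall r, g (quot_proj A r) = r *: e.
  have /choice[g gE] : forall q : quot_mod A, exists y : M,
      forall r, quot_proj A r = q -> y = r *: e.
    move=> q; have [x <-] := quot_projP q; exists (x *: e) => r /quot_proj_eq Arx.
    by apply/eqP; rewrite eq_sym -subr_eq0 -scalerBl Ae.
  by exists g => r; apply: gE.
have lg : linear g.
  move=> a p q; have [x <-] := quot_projP p; have [y <-] := quot_projP q.
  by rewrite quot_projZ -quot_projD !gE scalerDl scalerA.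
by exists (linear_of lg).
Qed.

Lemma quot_quot A B : A `<=` B ->
  exists g : {linear quot_mod A -> quot_mod B},
    forall r, g (quot_proj A r) = quot_proj B r.
Proof.
move=> AB; have [r Ar|g gE] := quot_map (A := A) (e := quot_proj B 1).
  by rewrite quot_projZ mulr1; apply/quot_proj0; apply: AB.
by exists g => r; rewrite gE quot_projZ mulr1.
Qed.

Lemma quot_mul A B z : (forall r, A r -> B (r * z)) ->
  exists g : {linear quot_mod A -> quot_mod B},
    forall r, g (quot_proj A r) = quot_proj B (r * z).
Proof.
move=> AB; have [r Ar|g gE] := quot_map (A := A) (e := quot_proj B z).
  by rewrite quot_projZ; apply/quot_proj0; apply: AB.
by exists g => r; rewrite gE quot_projZ.
Qed.

Lemma quot_surj A B (g : {linear quot_mod A -> quot_mod B}) :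
  (forall r, g (quot_proj A r) = quot_proj B r) -> forall c, exists b, g b = c.
Proof. by move=> gE c; have [x <-] := quot_projP c; exists (quot_proj A x). Qed.

(** Multiplication by [z] embeds R/(B : z) in R/B, with image the kernel of the projection onto R/(B
    + (z)). *)
Lemma adjoin_short_exact B z :
  exists (f : {linear quot_mod (quotient_elt B z) -> quot_mod B})
         (g : {linear quot_mod B -> quot_mod (adjoin B z)}), short_exact f g.
Proof.
have [|f fE] := @quot_mul (quotient_elt B z) B z; first by [].
have [|g gE] := @quot_quot B (adjoin B z); first exact: sub_adjoin.
exists f, g; split.
- move=> p q; have [x <-] := quot_projP p; have [y <-] := quot_projP q.
  rewrite !fE => /quot_proj_eq Bxy; apply/quot_proj_eq.
  by rewrite /ideal_has /= mulrBl.
- exact: quot_surj gE.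
move=> b; have [x <-] := quot_projP b; rewrite gE; split.
  move=> /quot_proj0[a [r [Ba ->]]]; exists (quot_proj _ r); rewrite fE.
  by apply/quot_proj_eq; rewrite opprD addrCA subrr addr0; apply: idealN.
move=> [q]; have [y <-] := quot_projP q; rewrite fE => /quot_proj_eq Byx.
apply/quot_proj0; exists (x - y * z), y; split; last by rewrite subrK.
by rewrite -opprB; apply: idealN.
Qed.

Lemma quotient_elt_nzd A t : nzd A t -> quotient_elt A t = A.
Proof.
move=> nt; apply: ideal_ext => w; split; last exact: ideal_mulr.
by rewrite /ideal_has /= mulrC; apply: nt.
Qed.

Lemma pd_le_adjoin n B z :
  pd_le n (quot_mod (quotient_elt B z)) -> pd_le n.+1 (quot_mod B) ->
  pd_le n.+1 (quot_mod (adjoin B z)).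
Proof. by have [f [g ex]] := adjoin_short_exact B z; apply: pd_le_cokernel ex. Qed.

Lemma pd_le_quotient_elt n B z :
  pd_le n (quot_mod B) -> pd_le n.+1 (quot_mod (adjoin B z)) ->
  pd_le n (quot_mod (quotient_elt B z)).
Proof. by have [f [g ex]] := adjoin_short_exact B z; apply: pd_le_kernel ex. Qed.

Lemma pd_le_adjoin_nzd n A t : nzd A t -> pd_le n (quot_mod A) ->
  pd_le n.+1 (quot_mod (adjoin A t)).
Proof.
move=> nt pA; apply: pd_le_adjoin; last exact: pd_leS.
by rewrite quotient_elt_nzd.
Qed.

Lemma pd_le_zero_ideal : pd_le 0 (quot_mod (zero_ideal R)).
Proof.
move=> A B g f gsurj; have [a ga] := gsurj (f (quot_proj _ 1)).
have [r ->|h hE] := quot_map (A := zero_ideal R) (e := a); first exact: scale0r.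
exists h => q; have [x <-] := quot_projP q.
by rewrite hE linearZ /= ga -linearZ /= quot_projZ mulr1.
Qed.

(* [(A + (b)) : I / A] and [(A + (c)) : I / A] correspond to each other under
   multiplication by the fraction [c / b]. *)
Lemma pd_le_link_step n A I b c : nzd A b -> nzd A c -> I b -> I c ->
  pd_le n (quot_mod A) -> pd_le n.+1 (quot_mod (colon (adjoin A b) I)) ->
  pd_le n.+1 (quot_mod (colon (adjoin A c) I)).
Proof.
move=> nb nc Ib Ic pA pb.
have Acolon t : A `<=` colon (adjoin A t) I.
  by move=> a Aa h _; apply: sub_adjoin; apply: ideal_mulr.
have [gb gbE] := quot_quot (Acolon b); have [gc gcE] := quot_quot (Acolon c).
have [mb mbE] : exists g : {linear quot_mod A -> quot_mod A},
    forall r, g (quot_proj A r) = quot_proj A (r * b).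
  by apply: quot_mul => r; apply: ideal_mulr.
have [mc mcE] : exists g : {linear quot_mod A -> quot_mod A},
    forall r, g (quot_proj A r) = quot_proj A (r * c).
  by apply: quot_mul => r; apply: ideal_mulr.
have mul_inj t (mt : {linear quot_mod A -> quot_mod A}) : nzd A t ->
    (forall r, mt (quot_proj A r) = quot_proj A (r * t)) -> injective mt.
  move=> nt mtE p q; have [x <-] := quot_projP p; have [y <-] := quot_projP q.
  rewrite !mtE => /quot_proj_eq; rewrite -mulrBl mulrC => /nt.
  by move=> ?; apply/quot_proj_eq.
have mb_inj := mul_inj _ _ nb mbE; have mc_inj := mul_inj _ _ nc mcE.
have kerE (k : kernel gb) :
    exists u, kernel_val gb k = quot_proj A u /\ colon (adjoin A b) I u.
  have [u uE] := quot_projP (kernel_val gb k); exists u; split=> //.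
  by apply/quot_proj0; rewrite -gbE uE kernel_val0.
(* [phi] is multiplication by [c / b]: the class of [u] goes to that of [v], where [u * c] and
   [v * b] agree modulo [A]. Such [v] exists since [u] maps [c] into [A + (b)]. *)
have [|phi phiE] := lift_inj (f := mc \o kernel_val gb) mb_inj.
  move=> k; have [u [kE Lu]] := kerE k; have [a [v [Aa E]]] := Lu c Ic.
  exists (quot_proj A v); rewrite mbE /= kE mcE; apply/quot_proj_eq.
  by rewrite E opprD addrCA subrr addr0; apply: idealN.
(* The image of [phi] is [((A + (c)) : I) / A], so R/((A + (c)) : I) is its cokernel. *)
apply: (pd_le_cokernel (f := phi) (g := gc) (n := n)) => //; last exact: pd_leS; last first.
  exact: pd_le_kernel (kernel_short_exact (quot_surj gbE)) pA pb.
split.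
- by move=> k l /(congr1 mb); rewrite !phiE => /mc_inj /kernel_val_inj.
- exact: quot_surj gcE.
move=> q; have [v <-] := quot_projP q; rewrite gcE; split.
  move=> /quot_proj0 Lv; have [a [w [Aa E]]] := Lv b Ib.
  have Lw : colon (adjoin A b) I w.
    move=> h Ih; rewrite mulrC; apply: (adjoin_cross (u := v) nc).
      by have -> : c * w - b * v = - a; [rewrite [b * v]mulrC E; ring | apply: idealN].
    by rewrite mulrC; apply: Lv.
  have [k kE] : exists k, kernel_val gb k = quot_proj A w.
    by apply/kernelP; rewrite gbE; apply/quot_proj0.
  exists k; apply: mb_inj; rewrite phiE /= kE mcE mbE; apply/quot_proj_eq.
  by rewrite E opprD addrCA subrr addr0; apply: idealN.
move=> [k kv]; have [u [kE Lu]] := kerE k.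
apply/quot_proj0 => h Ih; rewrite mulrC; apply: (adjoin_cross (u := u) nb).
  have := phiE k; rewrite kv mbE /= kE mcE => /quot_proj_eq.
  by rewrite [v * b]mulrC [u * c]mulrC.
by rewrite mulrC; apply: Lu.
Qed.

Lemma pd_le_linked n I a b c x y :
  nzd (zero_ideal R) a -> nzd (zero_ideal R) c -> nzd (zero_ideal R) x ->
  nzd (adjoin (zero_ideal R) a) b -> nzd (adjoin (zero_ideal R) a) c ->
  nzd (adjoin (zero_ideal R) x) c -> nzd (adjoin (zero_ideal R) x) y ->
  I a -> I b -> I c -> I x -> I y ->
  pd_le n.+2 (quot_mod (colon (adjoin (adjoin (zero_ideal R) a) b) I)) ->
  pd_le n.+2 (quot_mod (colon (adjoin (adjoin (zero_ideal R) x) y) I)).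
Proof.
move=> na nc nx nab nac nxc nxy Ia Ib Ic Ix Iy pab.
(* The two extra units in [n.+2] leave room for the dimension 1 of R/(t), as [n.+1] is at least
   1. *)
have pd1 t : nzd (zero_ideal R) t -> pd_le n.+1 (quot_mod (adjoin (zero_ideal R) t)).
  move=> nt; apply: (pd_le_leq (n := 1)) => //.
  by apply: pd_le_adjoin_nzd => //; apply: pd_le_zero_ideal.
have nca := nzd_adjoin_swap na nac; have ncx := nzd_adjoin_swap nx nxc.
have pac := pd_le_link_step nab nac Ib Ic (pd1 _ na) pab.
rewrite adjoinAC in pac.
have pcx := pd_le_link_step nca ncx Ia Ix (pd1 _ nc) pac.
rewrite adjoinAC in pcx.
exact: pd_le_link_step nxc nxy Ic Iy (pd1 _ nx) pcx.
Qed.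

Hypothesis noethR : noetherian R.

(* Every homomorphism [L -> R] is multiplication by an element of [R], so the
   dual basis of a projective [L] exhibits [1] as an element of [L]. *)
Lemma pd_le1_full L a b : nzd (zero_ideal R) a -> nzd (adjoin (zero_ideal R) a) b ->
  L a -> L b -> pd_le 1 (quot_mod L) -> L 1.
Proof.
move=> na nb La Lb pL; set Z := zero_ideal R in na nb *.
have [|g gE] := @quot_quot Z L; first by move=> x ->; apply: (ideal0 L).
(* [kernel g] is [L] as a module; a section [s] of its free cover by the generators [l] plays the
   part of a dual basis. *)
have pK : projective (kernel g).
  exact: (@pd_le_kernel _ 0) (kernel_short_exact (quot_surj gE)) pd_le_zero_ideal pL.
have [l Ll] := noeth_span noethR L.
have lphi : linear (fun v : 'rV[R]_(size l) => \sum_i v 0 i *: quot_proj Z l`_i).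
  move=> r u v; rewrite scaler_sumr -big_split; apply: eq_bigr => i _ /=.
  by rewrite !mxE scalerDl scalerA.
have [|phi [phiE _ phi_surj]] := kernel_map_exact (f := g) (k := linear_of lphi).
  move=> v; rewrite linear_sum big1 // => i _; rewrite linearZ /= gE.
  have /quot_proj0 -> : L l`_i by rewrite Ll; apply: span_gen; apply: mem_nth.
  by rewrite scaler0.
have [|s sK] := projective_section pK (g := phi).
  apply: phi_surj => q; have [x <-] := quot_projP q; rewrite gE => /quot_proj0.
  rewrite Ll => -[c ->]; exists (\row_i c i) => /=.
  by rewrite quot_proj_sum; apply: eq_bigr => i _; rewrite mxE quot_projZ.
have [ka kaE] : exists k, kernel_val g k = quot_proj Z a.
  by apply/kernelP; rewrite gE; apply/quot_proj0.
have [kb kbE] : exists k, kernel_val g k = quot_proj Z b.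
  by apply/kernelP; rewrite gE; apply/quot_proj0.
have kab : b *: ka = a *: kb.
  by apply: (@kernel_val_inj _ _ _ g); rewrite !linearZ /= kaE kbE !quot_projZ mulrC.
(* Since [b] times [s ka] is [a] times [s kb] and [b] is regular modulo [a], each coordinate of
   [s ka] is divisible by [a]. The quotients [c i] are the coefficients of 1 in the generators. *)
have /choice[c cE] : forall i, exists r, s ka 0 i = r * a.
  move=> i; have [|z [r [-> ->]]] := nb (s ka 0 i).
    exists 0, (s kb 0 i); split=> //; rewrite add0r [RHS]mulrC.
    have := congr1 (fun v : 'rV[R]_(size l) => v 0 i) (congr1 s kab).
    by rewrite !linearZ !mxE.
  by exists r; rewrite add0r.
have Zsum : Z (a * (\sum_i c i * l`_i - 1)).
  rewrite mulrBr mulr1; apply/quot_proj_eq; rewrite mulr_sumr quot_proj_sum.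
  have := phiE (s ka); rewrite sK kaE => ->; apply: eq_bigr => i _.
  by rewrite cE quot_projZ mulrA [c i * a]mulrC.
have /eqP := na _ Zsum; rewrite subr_eq0 => /eqP <-.
(* Spans take coefficients indexed by [nat], so [c] is extended by 0. *)
rewrite Ll; exists (fun i => if insub i is Some j then c j else 0).
by apply: eq_bigr => i _; rewrite valK.
Qed.

End QuotientModules.

(** * Infima and suprema of sets of natural numbers *)

Lemma inf_natP (A : set nat) :
  (exists n, [/\ inf_nat A = n%:Z%:E, A n & forall k, A k -> (n <= k)%N]) \/
  (inf_nat A = +oo%E /\ forall k, ~ A k).
Proof.
rewrite /inf_nat; case: pselect => [An|nA].
  left; case: ex_minnP => n; rewrite inE => An0 nmin; exists n; split=> // k Ak.
  by apply: nmin; rewrite inE.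
by right; split=> // k Ak; apply: nA; exists k; rewrite inE.
Qed.

Lemma EFin_int_inj (n k : nat) : n%:Z%:E = k%:Z%:E :> \bar int -> n = k.
Proof. by case. Qed.

Lemma inf_nat_eq (A : set nat) n : inf_nat A = n%:Z%:E ->
  A n /\ forall k, A k -> (n <= k)%N.
Proof.
by case: (inf_natP A) => [[k [-> Ak kmin]] /EFin_int_inj <-|[-> _]].
Qed.

Lemma sup_nat_max (A : set nat) k : A k -> (exists d, forall n, A n -> (n <= d)%N) ->
  exists n, [/\ sup_nat A = n%:Z%:E, A n & forall i, A i -> (i <= n)%N].
Proof.
move=> Ak [d Ad]; rewrite /sup_nat.
case: (inf_natP [set n | forall i, A i -> (i <= n)%N]) => [[n [-> /= An nmin]]|[_ /(_ d)]];
  last by [].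
exists n; split=> //; apply: contrapT => nAn.
have lt_n i : A i -> (i < n)%N.
  by move=> Ai; rewrite ltn_neqAle An // andbT; apply/eqP => ein; apply: nAn; rewrite -ein.
(* If [n] were not in [A], [n.-1] would be a smaller bound; [n] is positive because [k], a member of
   [A], is below it. *)
have := nmin n.-1 _; rewrite leqNgt prednK ?leqnn; last exact: leq_ltn_trans (lt_n _ Ak).
by move=> /(_ _)/negP; apply=> // i /lt_n; case: (n) => // n'; rewrite ltnS.
Qed.

(** * Translation between indexed and recursive prime chains *)

Section PrimeChains.
Variable R : comNzRingType.
Implicit Types (A B C I J K P Q : ideal R).

Lemma prime_chain_chain_to n (p : nat -> ideal R) i k : prime_chain n p ->
  (i + k <= n)%N -> chain_to k (p i) (p (i + k)%N).
Proof.
move=> [pp lt]; elim: k i => [|k IH] i; first by rewrite addn0.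
rewrite -addSnnS => ikn; exists (p i.+1); split; last exact: IH.
  by apply: pp; apply: leq_trans ikn; apply: leq_addr.
by apply: lt; apply: leq_trans ikn; apply: leq_addr.
Qed.

Lemma chain_to_prime_chain n P Q : prime_ideal P -> chain_to n P Q ->
  exists p, [/\ prime_chain n p, p 0%N = P & p n = Q].
Proof.
elim: n P => [|n IH] P pP; first by move=> <-; exists (fun=> P); split.
move=> [P' [pP' PP' /(IH _ pP')[p [[pp lt] p0 pn]]]].
exists (fun i => if i is j.+1 then p j else P); split=> //; split.
  by case=> // i; apply: pp.
by case=> [_|i]; [rewrite p0 | apply: lt].
Qed.

End PrimeChains.

(** * Regular local rings as Cohen-Macaulay domains *)

Section RegularLocal.
Variable R : comNzRingType.
Implicit Types (A B C H I J K P Q m : ideal R) (u v w x y z : R).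

Lemma ideal_set_inj A B : A = B :> set R -> A = B.
Proof. by move=> AB; apply: ideal_anti; rewrite AB. Qed.

Lemma maximal_local m : noetherian R -> maximal_ideal m ->
  (forall n, maximal_ideal n -> n = m :> set R) ->
  prime_ideal m /\ forall r, ~ m r -> exists s, s * r = 1.
Proof.
move=> noethR [m1 mmax] muniq.
have unit_out r : ~ m r -> exists s, s * r = 1.
  move=> nmr; case: (pselect (is_proper (adjoin (zero_ideal R) r))) => [pr|].
    have [M [pM rM Mmax]] := noeth_max noethR pr.
    have maxM : maximal_ideal M.
      split=> // I pI MI; apply: congr1; apply: contrapT => nIM.
      by apply: (Mmax I) => //; apply: proper_sub => // /esym.
    by case: nmr; rewrite -(ideal_set_inj (muniq M maxM)); apply: rM; apply: adjoin_gen.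
  move=> /contrapT[a [s [-> E]]].
  by exists s; rewrite E add0r.
split=> //; split=> // x y mxy; case: (pselect (m x)) => [|/unit_out[s sx]]; [by left|right].
by rewrite -[y]mul1r -sx -mulrA; apply: ideal_mull.
Qed.

(** [d] is at once the minimal number of generators of [m] and the Krull dimension, so a longest
    chain of primes and a minimal list of generators fit [regular_parameters] over the zero
    ideal. *)
Lemma regular_local_structure : regular_local R -> exists m d,
  [/\ prime_ideal m, forall r, ~ m r -> exists s, s * r = 1,
      prime_ideal (zero_ideal R), depth_ge m d (zero_ideal R)
    & forall k P Q, prime_ideal P -> chain_to k P Q -> (k <= d)%N].
Proof.
move=> [noethR [m [mmax muniq dimm]]].
have [pm unit_out] := maximal_local noethR mmax muniq.
have [d [gd [l [sl ml]] _]] : exists n, [/\ min_gens m = n%:Z%:E,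
    exists s, size s = n /\ m = ideal_span s :> set R & True].
  case: (inf_natP [set n | exists s, size s = n /\ m = ideal_span s :> set R]).
    by move=> [n [E Hn _]]; exists n.
  by move=> [_ nl]; have [l ml] := noethR m; case: (nl (size l)); exists l.
have [chd dmin] : (forall n, (exists p : nat -> ideal R, prime_chain n p) -> (n <= d)%N) /\
    forall e, (forall n, (exists p : nat -> ideal R, prime_chain n p) -> (n <= e)%N) -> (d <= e)%N.
  have kd : krull_dim R = d%:Z%:E by rewrite -dimm.
  exact: (inf_nat_eq kd).
have bound k P Q : prime_ideal P -> chain_to k P Q -> (k <= d)%N.
  by move=> pP /(chain_to_prime_chain pP)[p [pc _ _]]; apply: chd; exists p.
have [||e [De [p pc] emax]] :=
    @sup_nat_max [set n | exists p : nat -> ideal R, prime_chain n p] 0%N.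
- by exists (fun=> m); split.
- by exists d.
have ed : e = d.
  by apply/eqP; rewrite eqn_leq chd ?dmin //; exists p.
subst e; have pp i : (i <= d)%N -> prime_ideal (p i) by move: i; apply: (proj1 pc).
have chp := prime_chain_chain_to pc (i := 0%N) (leqnn d).
(* A longest chain ending below [m] could be prolonged by [m]. *)
have pdm : p d = m.
  have pdsub : p d `<=` m by apply: proper_sub_max => //; case: (pp d (leqnn _)).
  apply: contrapT => npdm; suff : (d.+1 <= d)%N by rewrite ltnn.
  rewrite -addn1; apply: (bound _ (p 0%N) m); first exact: pp.
  apply: chain_to_cat chp _; exists m; split=> //; exact: proper_sub.
have [p0 d0] : prime_ideal (zero_ideal R) /\ depth_ge m d (zero_ideal R).
  apply: (regular_parameters noethR pm unit_out sl (pp 0%N _)) => //.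
  - by move=> _ ->; apply: (ideal0 (p 0%N)).
  - by rewrite -[in X in chain_to _ _ X]pdm.
  by rewrite -ideal_span_adjoins; apply: ideal_set_inj.
by exists m, d; split.
Qed.

End RegularLocal.

(** * Ideals of height two in a regular local ring *)

Section HeightTwo.
Variables (R : comNzRingType) (m : ideal R) (d : nat).
Hypotheses (noethR : noetherian R) (pm : prime_ideal m).
Hypothesis unit_out : forall r, ~ m r -> exists s, s * r = 1.
Hypothesis domR : prime_ideal (zero_ideal R).
Hypothesis depthR : depth_ge m d (zero_ideal R).
Hypothesis dimR : forall k (P Q : ideal R), prime_ideal P -> chain_to k P Q -> (k <= d)%N.
Implicit Types (A B C H I J K P Q : ideal R) (u v w x y z : R).

Local Notation Z := (zero_ideal R).

Lemma prime_height_finite P : prime_ideal P -> exists n,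
  [/\ prime_height P = n%:Z%:E, exists2 P', prime_ideal P' & chain_to n P' P
    & forall k P', prime_ideal P' -> chain_to k P' P -> (k <= n)%N].
Proof.
move=> pP; have [||n [hP [p [pc pn]] nmax]] :=
    @sup_nat_max [set n | exists p, prime_chain n p /\ p n = P :> set R] 0%N.
- by exists (fun=> P); split.
- exists d => n [p [pc _]].
  exact: dimR (proj1 pc 0%N (leq0n n)) (prime_chain_chain_to (i := 0%N) pc (leqnn n)).
exists n; split=> //.
  exists (p 0%N); first exact: (proj1 pc).
  rewrite -(ideal_set_inj pn).
  exact: (prime_chain_chain_to (i := 0%N) pc (leqnn n)).
move=> k P' pP' /(chain_to_prime_chain pP')[q [qc q0 qk]].
by apply: nmax; exists q; rewrite qk.
Qed.

(* [ht P + depth R/A <= dim R] for [P] associated to [A]. *)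
Lemma assoc_height j k A u P : depth_ge m k A -> prime_ideal (quotient_elt A u) ->
  prime_ideal P -> chain_to j P (quotient_elt A u) -> (j + k <= d)%N.
Proof.
move=> dA pu pP Pu; have [M uM] := chain_from_assoc noethR pm unit_out dA pu.
exact: dimR pP (chain_to_cat Pu uM).
Qed.

Variable J : ideal R.
Hypothesis htJ : height J = 2%:Z%:E.

(** The height of [P] is at least two; the last two steps of a longest chain up to [P] are taken. *)
Lemma chain_below P : prime_ideal P -> J `<=` P ->
  exists2 P', prime_ideal P' & chain_to 2 P' P.
Proof.
move=> pP JP; have [n [hP [P0 pP0 P0P] _]] := prime_height_finite pP.
have [_ Jmin] := inf_nat_eq htJ.
have n2 : (2 <= n)%N by apply: Jmin; exists P; split.
have [p [pc p0 pn]] := chain_to_prime_chain pP0 P0P.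
exists (p (n - 2)%N); first by apply: (proj1 pc); apply: leq_subr.
have := prime_chain_chain_to (i := (n - 2)%N) (k := 2) pc.
by rewrite subnK // pn => /(_ (leqnn _)).
Qed.

Lemma prime_above : exists2 P, prime_ideal P & J `<=` P.
Proof. by have [[P [pP JP _]] _] := inf_nat_eq htJ; exists P. Qed.

Lemma J_sub_max : J `<=` m.
Proof.
have [P [nP1 _] JP] := prime_above.
by move=> x /JP; apply: proper_sub_max.
Qed.

Lemma dim_ge2 : (2 <= d)%N.
Proof.
have [P pP JP] := prime_above; have [P' pP' P'P] := chain_below pP JP.
exact: dimR P'P.
Qed.

(** A prime over [J] has height at least 2, an associated prime of [A] at most [d - k], which is
    below 2. *)
Lemma not_sub_assoc k A u : depth_ge m k A -> (d < k + 2)%N ->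
  prime_ideal (quotient_elt A u) -> ~ J `<=` quotient_elt A u.
Proof.
move=> dA dk pu Ju; have [P pP Pu] := chain_below pu Ju.
by have := assoc_height dA pu pP Pu; rewrite addnC leqNgt dk.
Qed.

Lemma domain_nzd x : x <> 0 -> nzd Z x.
Proof. by move=> x0; apply: prime_nzd. Qed.

Lemma three_generated_nonzero f g h : J = adjoin (adjoin (adjoin Z f) g) h ->
  exists x y z, x <> 0 /\ J = adjoin (adjoin (adjoin Z x) y) z.
Proof.
move=> JE; case: (pselect (f = 0)) => [f0|]; last by exists f, g, h.
case: (pselect (g = 0)) => [g0|]; last by exists g, f, h; rewrite (adjoinAC Z g f).
case: (pselect (h = 0)) => [h0|]; last first.
  by exists h, f, g; rewrite (adjoinAC Z h f) (adjoinAC (adjoin Z f) h g).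
have JZ : J `<=` Z.
  by rewrite JE f0 g0 h0; do 3!(apply: adjoin_min; last exact: ideal0).
have [P pP [P1 [_ _ [P2 [_ [_ nP2P1] P2Z]]]]] := chain_below domR JZ.
by case: nP2P1; rewrite P2Z => _ ->; apply: (ideal0 P1).
Qed.

(** R/(x) has depth at least [d.-1], so no associated prime of (x) contains [J]. Avoidance then
    finds a regular element in the coset [y + (z)], and replacing [y] by it does not change [J]. *)
Lemma three_generated_regular f g h : J = adjoin (adjoin (adjoin Z f) g) h ->
  exists x y z, [/\ nzd Z x, nzd (adjoin Z x) y
                  & J = adjoin (adjoin (adjoin Z x) y) z].
Proof.
move=> /three_generated_nonzero[x [y [z [x0 JE]]]].
have nx := domain_nzd x0.
have [Jx Jy Jz] : [/\ J x, J y & J z].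
  by rewrite JE; split; do ?[exact: adjoin_gen | apply: sub_adjoin].
have d2 := dim_ge2.
have dx : depth_ge m d.-1 (adjoin Z x).
  apply: (depth_ge_adjoin noethR pm unit_out) => //; last exact: J_sub_max.
  by rewrite prednK // (leq_trans _ d2).
have free u : adjoin Z x (y * u) ->
    (forall r, adjoin Z z r -> adjoin Z x (r * u)) -> adjoin Z x u.
  move=> yu zu; apply: contrapT => nxu.
  have [v [_ pv uv _]] := zero_divisor_assoc noethR nxu yu.
  apply: (not_sub_assoc dx _ pv); first by rewrite addn2 prednK ?ltnS // (leq_trans _ d2).
  rewrite JE; apply: adjoin_min; [apply: adjoin_min; [apply: adjoin_min|]|].
  - by move=> _ ->; apply: (ideal0 (quotient_elt (adjoin Z x) v)).
  - by apply: uv; apply: ideal_mulr; apply: adjoin_gen.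
  - exact: uv.
  - by apply: uv; apply: zu; apply: adjoin_gen.
have [_ [_ [r [-> ->]]] [ny _]] := nzd_avoidance noethR free free.
rewrite add0r in ny; exists x, (y + r * z), z; split=> //.
rewrite JE; apply: ideal_anti; apply: adjoin_min; try exact: adjoin_gen;
  apply: adjoin_min.
- by move=> w xw; do 2!apply: sub_adjoin.
- by apply: (ideal_addr (y := r * z)); [apply: sub_adjoin; apply: adjoin_gen
    | apply: ideal_mull; apply: adjoin_gen].
- by move=> w xw; do 2!apply: sub_adjoin.
- by apply: idealD; [apply: sub_adjoin; apply: adjoin_gen | apply: ideal_mull; apply: adjoin_gen].
Qed.

Lemma unmixed_part_sub I : unmixed_part J I -> J `<=` I.
Proof.
move=> [n [Q [[_ JE] IE]]] x Jx; rewrite IE => i _.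
by move: Jx; rewrite JE; apply.
Qed.

(* The components of [J] of height at least 3 lie in no associated prime of [R/B]. *)
Lemma unmixed_colon I B r : unmixed_part J I -> depth_ge m (d - 2) B ->
  (forall j, J j -> B (r * j)) -> forall i, I i -> B (r * i).
Proof.
move=> [n [Q [[_ JE] IE]]] dB rJ s Is; apply: contrapT => nBrs.
have [|v [_ pv rsv _]] := zero_divisor_assoc noethR (w := 0) nBrs.
  by rewrite mul0r; apply: ideal0.
set P := quotient_elt B v in pv rsv.
(* Such a component would have height exactly 2: at least 2 because it contains [J], at most 2
   because the depth hypothesis bounds the height of [P]. *)
suff [i [hi QP]] : exists i, height (Q i) <> height J /\ Q i `<=` P.
  apply: hi; rewrite htJ.
  have [k [hP [P' pP' P'P] _]] := prime_height_finite pv.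
  have k2 : (k <= 2)%N.
    by have := assoc_height dB pv pP' P'P; rewrite addnBA ?dim_ge2 // leq_subLR leq_add2r.
  have [_ Jmin] := inf_nat_eq htJ.
  have ge2 e : (exists P, [/\ prime_ideal P, Q i `<=` P & prime_height P = e%:Z%:E]) -> (2 <= e)%N.
    move=> [P2 [pP2 QP2 hP2]]; apply: Jmin; exists P2; split=> // x Jx.
    by apply: QP2; move: Jx; rewrite JE; apply.
  rewrite /height; case: (inf_natP [set n | exists P : ideal R,
      [/\ prime_ideal P, Q i `<=` P & prime_height P = n%:Z%:E]]) => [[e [-> He emin]]|[_ none]].
    have ek : (e <= k)%N by apply: emin; exists P; split.
    by congr (_%:Z%:E); apply/eqP; rewrite eqn_leq (leq_trans ek k2) ge2.
  by case: (none k); exists P; split.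
apply: contrapT => nex.
have /choice[q qP] : forall i, exists q, height (Q i) <> height J -> Q i q /\ ~ P q.
  move=> i; case: (pselect (height (Q i) = height J)) => [hi|hi]; first by exists 0.
  by have [|q qP] := @not_sub _ (Q i) P; [move=> QP; apply: nex; exists i | exists q].
(* [t] is outside [P] but in every component of the wrong height, so [t * s] is in [J]; then [t]
   kills [r * s] modulo [B] and must lie in [P]. *)
pose t := \prod_(i | `[< height (Q i) <> height J >]) q i.
have nPt : ~ P t.
  apply: (big_ind (fun x => ~ P x)); first by case: pv.
    by move=> x y nPx nPy /(proj2 pv)[].
  by move=> i /asboolP /qP[].
have Jts : J (t * s).
  rewrite /ideal_has JE => i _; case: (pselect (height (Q i) = height J)) => [hi|hi].
    by apply: (@ideal_mull _ (Q i)); move: Is; rewrite /ideal_has IE; apply.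
  apply: (@ideal_mulr _ (Q i)); rewrite /t (bigD1 i) /=; last exact/asboolP.
  by apply: (@ideal_mulr _ (Q i)); apply: (proj1 (qP i hi)).
apply: nPt; apply: rsv; rewrite /= mulrCA; exact: rJ.
Qed.

Lemma depth_ge_pair x y : J x -> J y -> nzd Z x -> nzd (adjoin Z x) y ->
  depth_ge m (d - 2) (adjoin (adjoin Z x) y).
Proof.
move=> /J_sub_max mx /J_sub_max my nx ny.
have step := depth_ge_adjoin noethR pm unit_out.
have := depthR; rewrite -{1}(subnK dim_ge2) addn2 => /step/(_ mx nx)/step.
exact.
Qed.

Lemma linkage_data I a b f g h : J = adjoin (adjoin (adjoin Z f) g) h ->
  unmixed_part J I -> I a -> I b -> nzd (adjoin Z a) b -> ~ adjoin Z a 1 ->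
  exists c x y z,
    [/\ nzd Z c, nzd Z x, nzd (adjoin Z a) c, nzd (adjoin Z x) c
      & nzd (adjoin Z x) y] /\
    [/\ I c, I x, I y, J = adjoin (adjoin (adjoin Z x) y) z
      & colon (adjoin (adjoin Z x) y) I = quotient_elt (adjoin (adjoin Z x) y) z].
Proof.
move=> JE IJ Ia Ib nb a1.
have [x [y [z [nx ny JE']]]] := three_generated_regular JE.
have [Jx Jy Jz] : [/\ J x, J y & J z].
  by rewrite JE'; split; do ?[exact: adjoin_gen | apply: sub_adjoin].
have JI := unmixed_part_sub IJ.
(* [I] contains [b], regular modulo [a], and [y], regular modulo [x], so it lies in no associated
   prime of (a) or (x), and one [c] serves both. *)
have [u _ Iu|u _ Iu|c Ic [nac nxc]] :=
    @nzd_avoidance _ noethR (adjoin Z a) (adjoin Z x) I 0.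
- by apply: nb; apply: Iu.
- by apply: ny; apply: Iu; apply: JI.
rewrite add0r in nac nxc.
(* If [c] were 0, its regularity modulo [a] would put 1 in (a). *)
have nc : nzd Z c.
  apply: domain_nzd => c0; apply: a1; apply: nac; rewrite c0 mul0r; exact: ideal0.
exists c, x, y, z; split=> //; split=> //; try exact: JI.
apply: ideal_ext => r; split=> [Ir|rz]; first by apply: Ir; apply: JI.
apply: (unmixed_colon IJ); first exact: depth_ge_pair.
move=> _ /[1!JE'][[e [s [Be ->]]]].
by rewrite mulrDr mulrCA; apply: idealD; apply: ideal_mull.
Qed.

End HeightTwo.

(** * Comparison of the two projective dimensions *)

Lemma pdimP (R : comNzRingType) (M : lmodType R) :
  (exists n, [/\ pdim M = n%:Z%:E, pd_le n M & forall k, pd_le k M -> (n <= k)%N]) \/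
  (pdim M = +oo%E /\ forall n, ~ pd_le n M).
Proof.
rewrite /pdim; case: (inf_natP [set n | has_proj_res M n]).
  move=> [n [-> /has_proj_res_pd_le Mn nmin]]; left; exists n; split=> // k.
  by move=> /pd_le_has_proj_res; apply: nmin.
by move=> [-> none]; right; split=> // n /pd_le_has_proj_res; apply: none.
Qed.

Lemma regular_seq2 (R : comNzRingType) (a b : R) : regular_seq [:: a; b] ->
  [/\ nzd (zero_ideal R) a, nzd (adjoin (zero_ideal R) a) b
    & ~ adjoin (zero_ideal R) a 1].
Proof.
move=> [nab reg]; split=> [w aw|w bw|a1].
- have : ideal_span [::] (w * a) -> ideal_span [::] w := reg 0%N isT w.
  by rewrite ideal_span_adjoins mulrC; apply.
- have : ideal_span [:: a] (w * b) -> ideal_span [:: a] w := reg 1%N isT w.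
  by rewrite ideal_span_adjoins mulrC; apply.
by apply: nab; rewrite span_seq2; apply: sub_adjoin.
Qed.

Theorem theorem7 (R : comNzRingType) (regR : regular_local R)
    (J : ideal R) (htJ : height J = 2%:Z%:E)
    (J3 : exists f g h : R, J = ideal_span [:: f; g; h] :> set R)
    (I : ideal R) (IJ : unmixed_part J I)
    (a b : R) (Ia : I a) (Ib : I b) (ab : regular_seq [:: a; b])
    (abI : ideal_span [:: a; b] <> I :> set R) :
  (pdim (quot_mod J) <= pdim (quot_mod (colon (ideal_span [:: a; b]) I)) + 1%:Z%:E)%E /\
  ((4%:Z%:E <= pdim (quot_mod J))%E ->
     pdim (quot_mod J) =
       (pdim (quot_mod (colon (ideal_span [:: a; b]) I)) + 1%:Z%:E)%E).
Proof.
have noethR := proj1 regR.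
have [m [d [pm unit_out domR depthR dimR]]] := regular_local_structure regR.
have [f [g [h /ideal_set_inj JE]]] := J3; rewrite span_seq3 in JE.
have [na nab a1] := regular_seq2 ab.
have [c [x [y [z [[nc nx nac nxc nxy] [Ic Ix Iy JE' LE]]]]]] :=
  linkage_data noethR pm unit_out domR depthR dimR htJ JE IJ Ia Ib nab a1.
rewrite span_seq2 in abI *; set L := colon _ I.
set B := adjoin (adjoin _ x) y in JE' LE.
(* The chain of links is run from [a, b] to [x, y], and then backwards. *)
have LB n : pd_le n.+2 (quot_mod L) -> pd_le n.+2 (quot_mod (quotient_elt B z)).
  by rewrite -LE; apply: pd_le_linked nc nx nab nac nxc nxy Ia Ib Ic Ix Iy.
have BL n : pd_le n.+2 (quot_mod (quotient_elt B z)) -> pd_le n.+2 (quot_mod L).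
  by rewrite -LE; apply: pd_le_linked nc na nxy nxc nac nab Ix Iy Ic Ia Ib.
have pdB : pd_le 2 (quot_mod B).
  by do 2!apply: pd_le_adjoin_nzd => //; apply: pd_le_zero_ideal.
(* A bound of at most 1 would make [L] the unit ideal and put [I] inside (a,b). *)
have pdL n : pd_le n (quot_mod L) -> (2 <= n)%N.
  rewrite ltnNge => pL; apply/negP => n1; apply: abI; congr ideal_set.
  apply: ideal_anti.
    by apply: adjoin_min => //; apply: adjoin_min => // _ ->; apply: (ideal0 I).
  have L1 : L 1.
    apply: (pd_le1_full noethR na nab) (pd_le_leq n1 pL) => i Ii.
      by apply: ideal_mulr; apply: sub_adjoin; apply: adjoin_gen.
    by apply: ideal_mulr; apply: adjoin_gen.
  by move=> i /L1; rewrite mul1r.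
have JL n : pd_le n (quot_mod L) -> pd_le n.+1 (quot_mod J).
  move=> pL; have := pdL n pL; case: n pL => [|[|n]] // pL _.
  by rewrite JE'; apply: pd_le_adjoin; [exact: LB | apply: pd_le_leq pdB].
(* The passage from R/J to R/(B : z) loses one, and R/B has dimension at most 2, within [n.+3]. *)
have LJ n : pd_le n.+4 (quot_mod J) -> pd_le n.+3 (quot_mod L).
  rewrite JE' => pJ; apply: BL; apply: pd_le_quotient_elt pJ.
  exact: pd_le_leq pdB.
case: (pdimP (quot_mod L)) => [[l [-> pL lmin]]|[-> noL]]; last first.
  case: (pdimP (quot_mod J)) => [[j [-> pJ jmin]]|[-> noJ]]; last by [].
  (* The bound [j] is raised to [j.+4], the form that [LJ] accepts. *)
  by case: (noL j.+3); apply: LJ; apply: pd_le_leq pJ; rewrite -addn4 leq_addr.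
case: (pdimP (quot_mod J)) => [[j [-> pJ jmin]]|[_ /(_ l.+1)]]; last by case; apply: JL.
have jl : (j <= l.+1)%N by apply: jmin; apply: JL.
rewrite -EFinD !lee_fin -PoszD addn1; split; first by rewrite lez_nat.
rewrite lez_nat => j4; congr (_%:Z%:E); apply/eqP; rewrite eqn_leq jl.
case: j j4 pJ {jl jmin} => [|[|[|[|j]]]] // _ pJ.
by rewrite ltnS; apply: lmin; apply: LJ.
Qed.
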